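(* Let $X$ be a Banach space and let $T:X\to X$ be a bounded linear operator. If $T$ satisfies the Strong Distributional Chaos Criterion with SDCC-constant $r$, then the following properties hold: (a) For any $r_0$ with $1\le r_0\le r$ we have $\sigma(T)\cap\partial D(0,r_0)\neq\emptyset$. (b) There do not exist disjoint closed subsets $F_1$ and $F_2$ of $\mathbb{C}$ such that $F_1\subset D(0,r)$, $F_2\subset\overline{\mathbb{D}}^{\,c}$ and $F_1\cup F_2=\sigma(T)$.
   Context: The operator $T$ satisfies the Strong Distributional Chaos Criterion (SDCC) with SDCC-constant $r$ if $r>1$ and for every positive integer $m$ there exists $x_m\in X\setminus\{0\}$ such that (i) $\lim_{k\to\infty}\|T^kx_m\|=0$ and (ii) $\|T^ix_m\|\ge r^i\|x_m\|$ for $i=1,2,\dots,m$. $\sigma(T)$ is the spectrum of $T$ (if $X$ is a real Banach space, the spectrum of its complexification). $D(0,\rho)=\{z\in\mathbb{C}:|z|<\rho\}$ is the open disc and $\partial D(0,\rho)$ is the circle of radius $\rho$ centred at $0$; $\overline{\mathbb{D}}^{\,c}=\{z\in\mathbb{C}:|z|>1\}$ is the complement of the closed unit disc. *)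

(* Defs.v *)
From Stdlib Require Import Reals Lra.
From Coquelicot Require Import Coquelicot.
Open Scope R_scope.

Lemma minus_zero_l_opp (G : AbelianGroup) (a : G) : minus zero a = opp a.
Proof. exact (plus_zero_l (opp a)). Qed.

Lemma plus_swap4 (G : AbelianGroup) (a b c d : G) :
  plus (plus a b) (plus c d) = plus (plus a c) (plus b d).
Proof.
rewrite <- !plus_assoc. f_equal. rewrite !plus_assoc. f_equal. apply plus_comm.
Qed.

Lemma minus_plus_swap (G : AbelianGroup) (a b c d : G) :
  minus (plus a b) (plus c d) = plus (minus a c) (minus b d).
Proof. unfold minus. rewrite opp_plus. apply plus_swap4. Qed.

Lemma minus_minus_swap (G : AbelianGroup) (a b c d : G) :
  minus (minus a b) (plus c d) = minus (minus a d) (plus b c).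
Proof.
unfold minus. rewrite !opp_plus, (plus_comm (opp c)). apply plus_swap4.
Qed.

Lemma plus_minus_swap (G : AbelianGroup) (a b c d : G) :
  plus (plus a b) (minus c d) = plus (minus a d) (plus b c).
Proof.
unfold minus. rewrite (plus_comm c). apply plus_swap4.
Qed.

Lemma norm_minus_le (K : AbsRing) (V : NormedModule K) (a b : V) :
  norm (minus a b) <= norm a + norm b.
Proof.
unfold minus. rewrite <- (norm_opp b). apply (norm_triangle a (opp b)).
Qed.

(** The pair [(x, y)] stands for [x + i y]. *)
Section Complexification.
Variable X : CompleteNormedModule R_AbsRing.

Definition cplx : Type := (X * X)%type.

Definition cplx_AbelianGroup : AbelianGroup := prod_AbelianGroup X X.

Definition cplx_scal (c : C) (z : cplx) : cplx :=
  (minus (scal (fst c) (fst z)) (scal (snd c) (snd z)),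
   plus (scal (fst c) (snd z)) (scal (snd c) (fst z))).

(** The Taylor norm [sup_t ||Re (e^(it) z)||], with [e^(it)] written as a
    complex number [u] of modulus 1. It extends the norm of [X], and induces
    the product topology. *)
Definition cplx_norm_set (z : cplx) (s : R) : Prop :=
  exists u : C, Cmod u = 1 /\ s = norm (fst (cplx_scal u z)).

Definition cplx_norm (z : cplx) : R := real (Lub_Rbar (cplx_norm_set z)).

Lemma norm_scal_le_1 (a : R) (x : X) :
  Rabs a <= 1 -> norm (scal a x) <= norm x.
Proof.
intros Ha. apply Rle_trans with (1 := norm_scal a x).
rewrite <- (Rmult_1_l (norm x)) at 2.
apply Rmult_le_compat_r; [apply norm_ge_0 | exact Ha].
Qed.

Lemma cplx_re_bound (u : C) (z : cplx) :
  Cmod u = 1 -> norm (fst (cplx_scal u z)) <= norm (fst z) + norm (snd z).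
Proof.
intros Hu.
assert (Hm := Rmax_Cmod u). rewrite Hu in Hm.
assert (H1 := Rmax_l (Rabs (fst u)) (Rabs (snd u))).
assert (H2 := Rmax_r (Rabs (fst u)) (Rabs (snd u))).
unfold cplx_scal; cbn [fst].
apply Rle_trans with (1 := norm_minus_le R_AbsRing X _ _).
apply Rplus_le_compat; apply norm_scal_le_1; lra.
Qed.

Lemma Cmod_1 : Cmod (RtoC 1) = 1.
Proof. rewrite Cmod_R. apply Rabs_R1. Qed.

Lemma cplx_norm_lub (z : cplx) :
  is_lub_Rbar (cplx_norm_set z) (Finite (cplx_norm z)).
Proof.
assert (H := Lub_Rbar_correct (cplx_norm_set z)).
unfold cplx_norm. destruct (Lub_Rbar (cplx_norm_set z)) as [l| |]; simpl.
- exact H.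
- destruct H as [_ H]. exfalso. apply (H (Finite (norm (fst z) + norm (snd z)))).
  intros s [u [Hu ->]]. apply cplx_re_bound, Hu.
- destruct H as [H _]. exfalso.
  apply (H _ (ex_intro _ (RtoC 1) (conj Cmod_1 eq_refl))).
Qed.

Lemma cplx_norm_ub (u : C) (z : cplx) :
  Cmod u = 1 -> norm (fst (cplx_scal u z)) <= cplx_norm z.
Proof.
intros Hu. destruct (cplx_norm_lub z) as [H _].
apply H. exists u. split; [exact Hu | reflexivity].
Qed.

Lemma cplx_norm_le (z : cplx) (M : R) :
  (forall u : C, Cmod u = 1 -> norm (fst (cplx_scal u z)) <= M) ->
  cplx_norm z <= M.
Proof.
intros HM. destruct (cplx_norm_lub z) as [_ H].
apply (H (Finite M)). intros s [u [Hu ->]]. apply HM, Hu.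
Qed.

Lemma scal_R0 (x : X) : scal (0 : R) x = zero.
Proof. exact (@scal_zero_l R_AbsRing X x). Qed.

Lemma scal_R1 (x : X) : scal (1 : R) x = x.
Proof. exact (@scal_one R_AbsRing X x). Qed.

Lemma minus_scal_R0 (x y : X) : minus x (scal (0 : R) y) = x.
Proof. rewrite scal_R0. exact (minus_zero_r x). Qed.

Lemma minus_scal_R0_l (x y : X) : minus (scal (0 : R) x) y = opp y.
Proof. rewrite scal_R0. exact (minus_zero_l_opp X y). Qed.

Lemma plus_scal_R0 (x y : X) : plus x (scal (0 : R) y) = x.
Proof. rewrite scal_R0. exact (plus_zero_r x). Qed.

Lemma cplx_norm_fst (z : cplx) : norm (fst z) <= cplx_norm z.
Proof.
apply Rle_trans with (2 := cplx_norm_ub (RtoC 1) z Cmod_1).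
unfold cplx_scal, RtoC; cbn [fst snd].
rewrite minus_scal_R0, scal_R1. apply Rle_refl.
Qed.

Lemma cplx_norm_snd (z : cplx) : norm (snd z) <= cplx_norm z.
Proof.
assert (Hi : Cmod Ci = 1).
{ transitivity (sqrt 1); [unfold Cmod, Ci; f_equal; simpl; ring | apply sqrt_1]. }
apply Rle_trans with (2 := cplx_norm_ub Ci z Hi).
unfold cplx_scal, Ci; cbn [fst snd].
rewrite minus_scal_R0_l, scal_R1. apply Req_le.
symmetry. exact (@norm_opp R_AbsRing X (snd z)).
Qed.

Lemma cplx_norm_sum (z : cplx) : cplx_norm z <= norm (fst z) + norm (snd z).
Proof. apply cplx_norm_le. intros u Hu. apply cplx_re_bound, Hu. Qed.

Lemma cplx_norm_real (x : X) : cplx_norm (x, zero) = norm x.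
Proof.
apply Rle_antisym; [| exact (cplx_norm_fst (x, zero))].
apply Rle_trans with (1 := cplx_norm_sum _). cbn [fst snd].
assert (E : norm (zero : X) = 0) by exact (@norm_zero R_AbsRing X).
rewrite E, Rplus_0_r. apply Rle_refl.
Qed.

Lemma scal_RM (a b : R) (x : X) : scal a (scal b x) = scal (a * b) x.
Proof. exact (@scal_assoc R_AbsRing X a b x). Qed.

Lemma scal_RD (a b : R) (x : X) : plus (scal a x) (scal b x) = scal (a + b) x.
Proof. symmetry. exact (@scal_distr_r R_AbsRing X a b x). Qed.

Lemma scal_RB (a b : R) (x : X) : minus (scal a x) (scal b x) = scal (a - b) x.
Proof. symmetry. exact (@scal_minus_distr_r R_AbsRing X a b x). Qed.

Lemma scal_RBl (a : R) (x y : X) :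
  scal a (minus x y) = minus (scal a x) (scal a y).
Proof. exact (@scal_minus_distr_l R_AbsRing X a x y). Qed.

Lemma scal_RDl (a : R) (x y : X) :
  scal a (plus x y) = plus (scal a x) (scal a y).
Proof. exact (@scal_distr_l R_AbsRing X a x y). Qed.

Lemma cplx_scal_assoc (a b : C) (z : cplx) :
  cplx_scal a (cplx_scal b z) = cplx_scal (Cmult a b) z.
Proof.
destruct a as [a1 a2], b as [b1 b2], z as [x y].
unfold cplx_scal, Cmult; cbn [fst snd].
rewrite !scal_RBl, !scal_RDl, !scal_RM. f_equal.
- now rewrite minus_minus_swap, scal_RB, scal_RD.
- rewrite <- scal_RB, <- scal_RD. apply (plus_minus_swap X).
Qed.

Lemma cplx_scal_one (z : cplx) : cplx_scal (RtoC 1) z = z.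
Proof.
destruct z as [x y]. unfold cplx_scal, RtoC; cbn [fst snd].
now rewrite minus_scal_R0, plus_scal_R0, !scal_R1.
Qed.

Lemma cplx_scal_distr_l (c : C) (z w : cplx_AbelianGroup) :
  (cplx_scal c (plus z w) : cplx_AbelianGroup)
  = plus (cplx_scal c z : cplx_AbelianGroup) (cplx_scal c w).
Proof.
destruct c as [a b], z as [x y], w as [x' y'].
change (cplx_scal (a, b) (plus x x', plus y y')
        = (plus (fst (cplx_scal (a, b) (x, y))) (fst (cplx_scal (a, b) (x', y'))),
           plus (snd (cplx_scal (a, b) (x, y))) (snd (cplx_scal (a, b) (x', y'))))).
unfold cplx_scal; cbn [fst snd]. rewrite !scal_RDl.
f_equal; [apply minus_plus_swap | apply plus_swap4].
Qed.

Lemma cplx_scal_distr_r (c d : C) (z : cplx_AbelianGroup) :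
  (cplx_scal (Cplus c d) z : cplx_AbelianGroup)
  = plus (cplx_scal c z : cplx_AbelianGroup) (cplx_scal d z).
Proof.
destruct c as [a b], d as [a' b'], z as [x y].
change (cplx_scal (a + a', b + b') (x, y)
        = (plus (fst (cplx_scal (a, b) (x, y))) (fst (cplx_scal (a', b') (x, y))),
           plus (snd (cplx_scal (a, b) (x, y))) (snd (cplx_scal (a', b') (x, y))))).
unfold cplx_scal; cbn [fst snd]. rewrite <- !scal_RD.
f_equal; [apply minus_plus_swap | apply plus_swap4].
Qed.

Definition cplx_ModuleSpace_mixin :
  ModuleSpace.mixin_of C_AbsRing cplx_AbelianGroup :=
  ModuleSpace.Mixin C_AbsRing cplx_AbelianGroup cplx_scal
    cplx_scal_assoc cplx_scal_one cplx_scal_distr_l cplx_scal_distr_r.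

Definition cplx_NormedModuleAux_class :
  NormedModuleAux.class_of C_AbsRing cplx :=
  NormedModuleAux.Class C_AbsRing cplx
    (ModuleSpace.Class C_AbsRing cplx
       (AbelianGroup.class cplx_AbelianGroup) cplx_ModuleSpace_mixin)
    (UniformSpace.class (prod_UniformSpace X X)).

Definition cplx_NormedModuleAux : NormedModuleAux C_AbsRing :=
  NormedModuleAux.Pack C_AbsRing cplx cplx_NormedModuleAux_class cplx.

Lemma cplx_norm_triangle (z w : cplx_NormedModuleAux) :
  cplx_norm (plus z w) <= cplx_norm z + cplx_norm w.
Proof.
apply cplx_norm_le. intros u Hu.
assert (E := cplx_scal_distr_l u z w). apply (f_equal fst) in E.
change (fst (cplx_scal u (plus z w))
        = plus (fst (cplx_scal u z)) (fst (cplx_scal u w))) in E.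
rewrite E. apply Rle_trans with (1 := @norm_triangle R_AbsRing X _ _).
apply Rplus_le_compat; apply cplx_norm_ub, Hu.
Qed.

Lemma cplx_norm_scal (c : C) (z : cplx) :
  cplx_norm (cplx_scal c z) <= Cmod c * cplx_norm z.
Proof.
apply cplx_norm_le. intros u Hu. rewrite cplx_scal_assoc.
destruct (Req_dec (Cmod c) 0) as [Hc|Hc].
- apply Cmod_eq_0 in Hc. subst c. rewrite Cmult_0_r.
  unfold cplx_scal; cbn [fst snd].
  rewrite minus_scal_R0, scal_R0, Cmod_0, Rmult_0_l.
  apply Req_le. exact (@norm_zero R_AbsRing X).
- assert (Hc' : RtoC (Cmod c) <> RtoC 0) by (intros E; now apply RtoC_inj in E).
  assert (Hv : Cmod (u * c / RtoC (Cmod c)) = 1).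
  { rewrite Cmod_div, Cmod_mult, Hu, Cmod_R by exact Hc'.
    rewrite Rabs_pos_eq by apply Cmod_ge_0. field. exact Hc. }
  replace (u * c)%C with (RtoC (Cmod c) * (u * c / RtoC (Cmod c)))%C
    by (field; exact Hc').
  rewrite <- cplx_scal_assoc.
  set (w := cplx_scal (u * c / RtoC (Cmod c)) z).
  replace (fst (cplx_scal (RtoC (Cmod c)) w)) with (scal (Cmod c) (fst w)).
  2:{ unfold cplx_scal, RtoC; cbn [fst snd].
      now rewrite minus_scal_R0. }
  apply Rle_trans with (1 := norm_scal (Cmod c : R_AbsRing) (fst w)).
  change (abs (Cmod c : R_AbsRing)) with (Rabs (Cmod c)).
  rewrite Rabs_pos_eq by apply Cmod_ge_0.
  apply Rmult_le_compat_l; [apply Cmod_ge_0 | apply cplx_norm_ub, Hv].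
Qed.

Lemma cplx_norm_compat1 (z w : cplx_NormedModuleAux) (eps : R) :
  cplx_norm (minus w z) < eps -> ball z eps w.
Proof.
intros H. split; apply (@norm_compat1 R_AbsRing X).
- apply Rle_lt_trans with (2 := H). apply (cplx_norm_fst (minus w z)).
- apply Rle_lt_trans with (2 := H). apply (cplx_norm_snd (minus w z)).
Qed.

Lemma cplx_norm_compat2 (z w : cplx_NormedModuleAux) (eps : posreal) :
  ball z eps w -> cplx_norm (minus w z) < (2 * @norm_factor R_AbsRing X) * eps.
Proof.
intros [H1 H2]. apply Rle_lt_trans with (1 := cplx_norm_sum _).
assert (N1 := @norm_compat2 R_AbsRing X (fst z) (fst w) eps H1).
assert (N2 := @norm_compat2 R_AbsRing X (snd z) (snd w) eps H2).
replace (2 * @norm_factor R_AbsRing X * eps)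
  with (@norm_factor R_AbsRing X * eps + @norm_factor R_AbsRing X * eps) by ring.
exact (Rplus_lt_compat _ _ _ _ N1 N2).
Qed.

Lemma cplx_norm_eq_0 (z : cplx_NormedModuleAux) : cplx_norm z = 0 -> z = zero.
Proof.
intros H. assert (H1 := cplx_norm_fst z). assert (H2 := cplx_norm_snd z).
rewrite H in H1, H2. destruct z as [x y]; cbn [fst snd] in *.
change ((x, y) = (zero, zero)).
f_equal; apply (@norm_eq_zero R_AbsRing X); apply Rle_antisym; trivial; apply norm_ge_0.
Qed.

Definition cplx_NormedModule_mixin :
  NormedModule.mixin_of C_AbsRing cplx_NormedModuleAux :=
  NormedModule.Mixin C_AbsRing cplx_NormedModuleAux cplx_norm
    (2 * @norm_factor R_AbsRing X) cplx_norm_triangle cplx_norm_scal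
    cplx_norm_compat1 cplx_norm_compat2 cplx_norm_eq_0.

Definition cplx_lim (F : (cplx -> Prop) -> Prop) : cplx :=
  (lim (filtermap fst F), lim (filtermap snd F)).

Lemma cplx_complete (F : (prod_UniformSpace X X -> Prop) -> Prop) :
  ProperFilter F -> cauchy F ->
  forall eps : posreal, F (ball (cplx_lim F : prod_UniformSpace X X) eps).
Proof.
intros FF HF eps.
assert (P1 : ProperFilter (filtermap fst F)) by now apply filtermap_proper_filter.
assert (P2 : ProperFilter (filtermap snd F)) by now apply filtermap_proper_filter.
assert (H1 : filtermap fst F (ball (lim (filtermap fst F)) eps)).
{ apply complete_cauchy; trivial. intros d. destruct (HF d) as [z Hz].
  exists (fst z). unfold filtermap.
  apply filter_imp with (2 := Hz). intros w [Hw _]. exact Hw. }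
assert (H2 : filtermap snd F (ball (lim (filtermap snd F)) eps)).
{ apply complete_cauchy; trivial. intros d. destruct (HF d) as [z Hz].
  exists (snd z). unfold filtermap.
  apply filter_imp with (2 := Hz). intros w [_ Hw]. exact Hw. }
unfold filtermap at 1 in H1. unfold filtermap at 1 in H2.
generalize (filter_and _ _ H1 H2). apply filter_imp. intros w Hw. exact Hw.
Qed.

Lemma cplx_close_lim (F G : (prod_UniformSpace X X -> Prop) -> Prop) :
  filter_le F G -> filter_le G F ->
  close (cplx_lim F : prod_UniformSpace X X) (cplx_lim G).
Proof.
intros H1 H2 eps. split.
- apply (close_lim (filtermap fst F) (filtermap fst G));
    intros P HP; [exact (H1 _ HP) | exact (H2 _ HP)].
- apply (close_lim (filtermap snd F) (filtermap snd G));
    intros P HP; [exact (H1 _ HP) | exact (H2 _ HP)].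
Qed.

Definition complexification : CompleteNormedModule C_AbsRing :=
  CompleteNormedModule.Pack C_AbsRing cplx
    (CompleteNormedModule.Class C_AbsRing cplx
       (NormedModule.Class C_AbsRing cplx
          cplx_NormedModuleAux_class cplx_NormedModule_mixin)
       (CompleteSpace.Mixin (prod_UniformSpace X X) cplx_lim
          cplx_complete cplx_close_lim))
    cplx.

Definition complexify (T : X -> X) : complexification -> complexification :=
  fun z => (T (fst z), T (snd z)).

End Complexification.

Lemma complexify_linear (X : CompleteNormedModule R_AbsRing) (T : X -> X) :
  is_linear T -> is_linear (complexify X T).
Proof.
intros HT. split.
- intros z w. unfold complexify.
  change ((T (plus (fst z) (fst w)), T (plus (snd z) (snd w)))
          = (plus (T (fst z)) (T (fst w)), plus (T (snd z)) (T (snd w)))).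
  now rewrite !(linear_plus _ HT).
- intros c z. unfold complexify.
  change ((T (fst (cplx_scal X c z)), T (snd (cplx_scal X c z)))
          = cplx_scal X c (T (fst z), T (snd z))).
  unfold cplx_scal; cbn [fst snd].
  rewrite (linear_plus _ HT), <- !(linear_scal _ HT). f_equal.
  unfold minus. rewrite (linear_plus _ HT). f_equal.
  exact (@linear_opp R_AbsRing X X T _ HT).
- destruct (linear_norm _ HT) as [M [HM H]]. exists (2 * M). split; [lra|].
  intros z.
  change (cplx_norm X (T (fst z), T (snd z)) <= 2 * M * cplx_norm X z).
  apply Rle_trans with (1 := cplx_norm_sum X _); cbn [fst snd].
  assert (H1 := H (fst z)). assert (H2 := H (snd z)).
  assert (H3 := cplx_norm_fst X z). assert (H4 := cplx_norm_snd X z).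
  apply (Rmult_le_compat_l M) in H3; [|lra].
  apply (Rmult_le_compat_l M) in H4; [|lra]. lra.
Qed.

(** [is_linear] comprises boundedness, so [S] ranges over the bounded linear
    operators. *)
Definition spectrum {X : NormedModule C_AbsRing} (T : X -> X) (lambda : C) : Prop :=
  ~ exists S : X -> X,
      is_linear S /\
      (forall x : X, S (minus (T x) (scal lambda x)) = x) /\
      (forall x : X, minus (T (S x)) (scal lambda (S x)) = x).

(** Strong Distributional Chaos Criterion with constant [r]. *)
Definition SDCC {K : AbsRing} {X : NormedModule K} (T : X -> X) (r : R) : Prop :=
  1 < r /\
  forall m : nat, (1 <= m)%nat ->
    exists x : X,
      x <> zero /\
      is_lim_seq (fun k => norm (Nat.iter k T x)) 0 /\
      (forall i : nat, (1 <= i <= m)%nat ->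
         r ^ i * norm x <= norm (Nat.iter i T x)).

(* Main.v *)
Require Import Defs.
From Stdlib Require Import Reals Lra Lia Classical List IndefiniteDescription.
From Coquelicot Require Import Coquelicot.
Open Scope R_scope.

(** Both parts follow from one fact about a complex Banach space: the approximate
    eigenvalues of [T] cannot be split into a closed set inside the disc of radius
    [r] and a disjoint closed set outside the closed unit disc. For (b) the
    two sets are the given ones; for (a), if the spectrum missed the circle of
    radius [r0], that circle would itself split the approximate eigenvalues. The
    complexification of a real operator inherits the criterion, with the vectors
    [x_m + i 0].

    A mathematician would take the Riesz projections of the two pieces. The
    argument here uses no contour around them. In the variable [s = 1 / z], let
    [x] be a vector with [T^k x -> 0] and let [w(s) = sum_k s^k T^k x], which is
    analytic on the open unit disc and solves [(1 - s T) w(s) = x]. Write [S1] and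
    [S2] for the sets of inverses of the two pieces: [S1] lies outside
    the closed disc of radius [1 / r], and [S2] inside the open unit disc.
    Let [K] be the union of a disc of radius [q], slightly larger than [1 / r], and
    of a small neighbourhood of [S2]. Near the boundary of [K] the operators
    [1 - s T] are bounded below, uniformly by compactness
    ([bounded_below_margin]), so that there [norm (w s) <= norm x / c] with [c]
    independent of [x]. By the maximum principle ([maximum_principle]) this bound
    holds throughout [K], across the singular points in [S2]: this is where
    [T^k x -> 0] enters, as it makes [w] analytic there. Cauchy's inequality on the
    circle of radius [q] ([cauchy_estimate]) then gives
    [q^m norm (T^m x) <= norm x / c]. With [x = x_m] and
    [r^m norm x <= norm (T^m x)] this bounds [(q r)^m] by [1 / c] for every [m],
    whereas [q r > 1] ([SDCC_no_separation]).

    The analysis is carried out on the equation [(1 - s T) w = x] alone, for [w] with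
    a bounded orbit. The resolvent identity gives the Taylor expansion of [w] with
    a cubic error, hence an approximate mean value property over four points, which
    is enough for the maximum principle. Cauchy's inequality is obtained by
    repeatedly splitting the series into its even and odd parts, each of which is
    again such a series, for [T^2] at [s^2]. *)

(** * Linear identities in a complex vector space *)

Inductive lin_expr : Type :=
| LAtom (i : nat)
| LZero
| LPlus (a b : lin_expr)
| LOpp (a : lin_expr)
| LScal (c : C) (a : lin_expr).

Fixpoint lin_coef (e : lin_expr) (i : nat) : C :=
  match e with
  | LAtom j => if Nat.eqb i j then 1 else 0
  | LZero => 0
  | LPlus a b => lin_coef a i + lin_coef b i
  | LOpp a => - lin_coef a i
  | LScal c a => c * lin_coef a i
  end%C.

Section LinearExpressions.
Variable X : NormedModule C_AbsRing.

Fixpoint lin_eval (env : list X) (e : lin_expr) : X :=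
  match e with
  | LAtom i => nth i env zero
  | LZero => zero
  | LPlus a b => plus (lin_eval env a) (lin_eval env b)
  | LOpp a => opp (lin_eval env a)
  | LScal c a => scal (c : C_AbsRing) (lin_eval env a)
  end.

Fixpoint lin_comb (c : nat -> C) (env : list X) : X :=
  match env with
  | nil => zero
  | v :: env' => plus (scal (c 0%nat : C_AbsRing) v) (lin_comb (fun i => c (S i)) env')
  end.

Lemma lin_comb_zero (env : list X) : lin_comb (fun _ => RtoC 0) env = zero.
Proof.
induction env as [|v env IH]; simpl; [reflexivity|].
rewrite IH, plus_zero_r. exact (scal_zero_l v).
Qed.

Lemma lin_comb_plus (c d : nat -> C) (env : list X) :
  lin_comb (fun i => Cplus (c i) (d i)) env = plus (lin_comb c env) (lin_comb d env).
Proof.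
revert c d. induction env as [|v env IH]; intros c d; simpl.
- symmetry. apply plus_zero_l.
- rewrite (IH (fun i => c (S i)) (fun i => d (S i))), (plus_swap4 X). f_equal.
  exact (scal_distr_r (c 0%nat : C_AbsRing) (d 0%nat) v).
Qed.

Lemma lin_comb_scal (a : C) (c : nat -> C) (env : list X) :
  lin_comb (fun i => Cmult a (c i)) env = scal (a : C_AbsRing) (lin_comb c env).
Proof.
revert c. induction env as [|v env IH]; intros c; simpl.
- symmetry. exact (scal_zero_r (a : C_AbsRing)).
- rewrite (IH (fun i => c (S i))), scal_distr_l. f_equal.
  symmetry. exact (scal_assoc (a : C_AbsRing) (c 0%nat) v).
Qed.

Lemma lin_comb_ext (c d : nat -> C) (env : list X) :
  (forall i, (i < length env)%nat -> c i = d i) -> lin_comb c env = lin_comb d env.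
Proof.
revert c d. induction env as [|v env IH]; intros c d H; simpl; [reflexivity|].
rewrite (H 0%nat) by (simpl; lia). f_equal. apply IH.
intros i Hi. apply H. simpl. lia.
Qed.

Lemma lin_comb_atom (j : nat) (env : list X) :
  lin_comb (fun i => if Nat.eqb i j then RtoC 1 else RtoC 0) env = nth j env zero.
Proof.
revert j. induction env as [|v env IH]; intros [|j]; simpl; try reflexivity.
- rewrite lin_comb_zero, plus_zero_r. exact (scal_one v).
- rewrite IH. rewrite <- (plus_zero_l (nth j env zero)) at 2. f_equal.
  exact (scal_zero_l v).
Qed.

Lemma lin_eval_comb (env : list X) (e : lin_expr) :
  lin_eval env e = lin_comb (lin_coef e) env.
Proof.
induction e as [j| |a IHa b IHb|a IHa|c a IHa]; simpl.
- symmetry. apply lin_comb_atom.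
- symmetry. apply lin_comb_zero.
- rewrite IHa, IHb. symmetry. apply lin_comb_plus.
- rewrite IHa. transitivity (scal (Copp 1 : C_AbsRing) (lin_comb (lin_coef a) env)).
  + symmetry. exact (scal_opp_one (lin_comb (lin_coef a) env)).
  + rewrite <- lin_comb_scal. apply lin_comb_ext. intros i _. ring.
- rewrite IHa. symmetry. apply lin_comb_scal.
Qed.

Fixpoint coef_agree (n : nat) (a b : lin_expr) : Prop :=
  match n with
  | O => True
  | S n => lin_coef a n = lin_coef b n /\ coef_agree n a b
  end.

Lemma coef_agree_lt (n : nat) (a b : lin_expr) :
  coef_agree n a b -> forall i, (i < n)%nat -> lin_coef a i = lin_coef b i.
Proof.
induction n as [|n IH]; intros H i Hi; [lia|]. destruct H as [H0 H].
destruct (Nat.eq_dec i n) as [->|Hn]; [exact H0|]. apply IH; [exact H|lia].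
Qed.

Lemma lin_eval_eq (env : list X) (a b : lin_expr) :
  coef_agree (length env) a b -> lin_eval env a = lin_eval env b.
Proof.
intros H. rewrite !lin_eval_comb. apply lin_comb_ext, coef_agree_lt, H.
Qed.

End LinearExpressions.

Ltac atom_index env v :=
  lazymatch env with
  | v :: _ => constr:(O)
  | _ :: ?env' => let n := atom_index env' v in constr:(S n)
  end.

Ltac reify_lin env t :=
  lazymatch t with
  | plus ?a ?b =>
      let a' := reify_lin env a in let b' := reify_lin env b in constr:(LPlus a' b')
  | minus ?a ?b =>
      let a' := reify_lin env a in let b' := reify_lin env b in
      constr:(LPlus a' (LOpp b'))
  | opp ?a => let a' := reify_lin env a in constr:(LOpp a')
  | scal ?c ?a => let a' := reify_lin env a in constr:(LScal c a')
  | zero => constr:(LZero)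
  | _ => let n := atom_index env t in constr:(LAtom n)
  end.

(** A linear identity between vectors is settled by comparing the coefficients on
    each vector of [env], which leaves identities between complex numbers. *)
Ltac lin_coefs env :=
  lazymatch goal with
  | |- @eq ?X ?a ?b =>
      let a' := reify_lin env a in
      let b' := reify_lin env b in
      lazymatch type of env with
      | list (CompleteNormedModule.sort _ ?Y) => apply (lin_eval_eq Y env a' b')
      end;
      cbn [coef_agree lin_coef length Nat.eqb]; repeat split
  end.

Ltac expand_linear HT :=
  repeat first
    [ rewrite (linear_plus _ HT) | rewrite (linear_minus _ _ _ HT)
    | rewrite (linear_opp _ _ HT) | rewrite (linear_scal _ HT) ].

(** * Resolvent vectors along a bounded orbit *)

Section Orbits.
Variable X : CompleteNormedModule C_AbsRing.

Lemma norm_scal_Cmod (c : C) (x : X) : norm (scal c x) <= Cmod c * norm x.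
Proof. exact (@norm_scal C_AbsRing X c x). Qed.

Lemma norm_plus_le (x y : X) : norm (plus x y) <= norm x + norm y.
Proof. exact (@norm_triangle C_AbsRing X x y). Qed.

Lemma norm_plus_scal_le (c : C) (x y : X) :
  norm (plus x (scal c y)) <= norm x + Cmod c * norm y.
Proof.
apply Rle_trans with (1 := norm_plus_le _ _).
apply Rplus_le_compat_l, norm_scal_Cmod.
Qed.

Lemma norm_minus_scal_le (c : C) (x y : X) :
  norm (minus x (scal c y)) <= norm x + Cmod c * norm y.
Proof.
apply Rle_trans with (1 := norm_minus_le C_AbsRing X x (scal c y)).
apply Rplus_le_compat_l, norm_scal_Cmod.
Qed.

Definition orbit_le (T : X -> X) (B : R) (x : X) : Prop :=
  forall k : nat, norm (Nat.iter k T x) <= B.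

Lemma orbit_le_0 (T : X -> X) (B : R) (x : X) : orbit_le T B x -> norm x <= B.
Proof. intros H. exact (H 0%nat). Qed.

Lemma orbit_le_nonneg (T : X -> X) (B : R) (x : X) : orbit_le T B x -> 0 <= B.
Proof.
intros H. apply Rle_trans with (2 := orbit_le_0 T B x H). apply norm_ge_0.
Qed.

Lemma iter_linear (T : X -> X) (k : nat) : is_linear T -> is_linear (Nat.iter k T).
Proof.
intros HT. induction k as [|k IH]; simpl.
- apply is_linear_id.
- exact (is_linear_comp _ _ IH HT).
Qed.

Lemma orbit_le_iter (T : X -> X) (B : R) (x : X) (m : nat) :
  orbit_le T B x -> orbit_le T B (Nat.iter m T x).
Proof. intros H k. rewrite <- Nat.iter_add. apply H. Qed.

Lemma orbit_le_weaken (T : X -> X) (B B' : R) (x : X) :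
  B <= B' -> orbit_le T B x -> orbit_le T B' x.
Proof. intros HB H k. exact (Rle_trans _ _ _ (H k) HB). Qed.

Definition orbit_bounded (T : X -> X) (w : X) : Prop := exists B : R, orbit_le T B w.

Lemma orbit_bounded_plus (T : X -> X) (x y : X) :
  is_linear T -> orbit_bounded T x -> orbit_bounded T y -> orbit_bounded T (plus x y).
Proof.
intros HT [B Hx] [B' Hy]. exists (B + B'). intros k.
rewrite (linear_plus _ (iter_linear T k HT)).
apply Rle_trans with (1 := norm_plus_le _ _).
apply Rplus_le_compat; [apply Hx | apply Hy].
Qed.

Lemma orbit_bounded_scal (T : X -> X) (c : C) (x : X) :
  is_linear T -> orbit_bounded T x -> orbit_bounded T (scal c x).
Proof.
intros HT [B Hx]. exists (Cmod c * B). intros k.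
rewrite (linear_scal _ (iter_linear T k HT)).
apply Rle_trans with (1 := norm_scal_Cmod _ _).
apply Rmult_le_compat_l; [apply Cmod_ge_0 | apply Hx].
Qed.

Lemma orbit_bounded_minus (T : X -> X) (x y : X) :
  is_linear T -> orbit_bounded T x -> orbit_bounded T y -> orbit_bounded T (minus x y).
Proof.
intros HT Hx Hy.
replace (minus x y) with (plus x (scal (Copp 1) y))
  by (lin_coefs (x :: y :: nil); ring).
apply orbit_bounded_plus, orbit_bounded_scal; trivial.
Qed.

(** [w] plays the role of [(1 - s T)^-1 x], selected among all solutions by the
    boundedness of its orbit; for [Cmod s < 1] this makes it the sum of
    [s^k T^k x] even when [1 - s T] is not invertible. *)
Definition resolvent_vector (T : X -> X) (s : C) (x w : X) : Prop :=
  orbit_bounded T w /\ minus w (scal s (T w)) = x.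

Lemma le_of_geometric_defect (a b c q : R) :
  0 <= q < 1 -> 0 <= c -> (forall n : nat, a <= b + q ^ n * c) -> a <= b.
Proof.
intros Hq Hc H.
assert (L : is_lim_seq (fun n => b + q ^ n * c) (b + 0 * c)).
{ apply is_lim_seq_plus'; [apply is_lim_seq_const|].
  apply is_lim_seq_mult'; [|apply is_lim_seq_const].
  apply is_lim_seq_geom. rewrite Rabs_pos_eq; lra. }
assert (L' := is_lim_seq_le _ _ _ _ H (is_lim_seq_const a) L).
simpl in L'. lra.
Qed.

Lemma bounded_contraction_le (u : nat -> R) (B B' q : R) :
  0 <= q < 1 -> 0 <= B' -> (forall k, u k <= B') ->
  (forall k, u k <= B + q * u (S k)) ->
  forall k, u k <= B / (1 - q).
Proof.
intros Hq HB' Hb Hu k.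
set (L := B / (1 - q)).
assert (HL : L = B + q * L) by (unfold L; field; lra).
set (c := Rabs L + B').
assert (Hc : 0 <= c) by (unfold c; assert (H := Rabs_pos L); lra).
apply le_of_geometric_defect with (q := q) (c := c); [exact Hq|exact Hc|].
intros n. revert k. induction n as [|n IH]; intros k.
- assert (H := Hb k). assert (H1 := Rle_abs (- L)). rewrite Rabs_Ropp in H1.
  unfold c. simpl. lra.
- apply Rle_trans with (1 := Hu k).
  assert (H := Rmult_le_compat_l q _ _ (proj1 Hq) (IH (S k))). simpl. lra.
Qed.

(** Since [T^k w = T^k x + s T^(k+1) w], the numbers [norm (T^k w)] satisfy a
    contractive inequality, whose bounded solutions obey the geometric bound. *)
Lemma resolvent_vector_orbit_le (T : X -> X) (s : C) (B : R) (x w : X) :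
  is_linear T -> Cmod s < 1 -> orbit_le T B x -> resolvent_vector T s x w ->
  orbit_le T (B / (1 - Cmod s)) w.
Proof.
intros HT Hs Hx [[B' Hw] E].
refine (bounded_contraction_le (fun k => norm (Nat.iter k T w)) B B' _ _ _ _ _).
- split; [apply Cmod_ge_0 | exact Hs].
- exact (orbit_le_nonneg T B' w Hw).
- exact Hw.
- intros k. assert (HTk := iter_linear T k HT).
  replace (Nat.iter k T w) with (plus (Nat.iter k T x) (scal s (Nat.iter (S k) T w))).
  + apply Rle_trans with (1 := norm_plus_scal_le _ _ _).
    apply Rplus_le_compat_r, Hx.
  + rewrite Nat.iter_succ_r, <- E, (linear_minus _ _ _ HTk), (linear_scal _ HTk).
    lin_coefs (Nat.iter k T w :: Nat.iter k T (T w) :: nil); ring.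
Qed.

Lemma norm_le_lim (u : nat -> X) (l : X) (B : R) :
  filterlim u eventually (locally l) -> (forall n, norm (u n) <= B) -> norm l <= B.
Proof.
intros Hu HB.
assert (L : is_lim_seq (fun n => norm (u n)) (norm l)).
{ exact (filterlim_comp _ _ _ u norm _ _ _ Hu (filterlim_norm l)). }
exact (is_lim_seq_le _ _ _ _ HB L (is_lim_seq_const B)).
Qed.

Lemma linear_sum_n (L : X -> X) (a : nat -> X) (n : nat) :
  is_linear L -> L (sum_n a n) = sum_n (fun k => L (a k)) n.
Proof.
intros HL. induction n as [|n IH].
- now rewrite !sum_O.
- now rewrite !sum_Sn, (linear_plus _ HL), IH.
Qed.

Lemma linear_is_series (L : X -> X) (a : nat -> X) (l : X) :
  is_linear L -> is_series a l -> is_series (fun k => L (a k)) (L l).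
Proof.
intros HL Ha. unfold is_series.
apply filterlim_ext with (f := fun n => L (sum_n a n)).
- intros n. apply linear_sum_n, HL.
- exact (filterlim_comp _ _ _ _ L _ _ _ Ha (linear_cont L l HL)).
Qed.

Lemma norm_sum_n_geom_le (a : nat -> X) (B q : R) (n : nat) :
  0 <= q < 1 -> 0 <= B -> (forall k, norm (a k) <= B * q ^ k) ->
  norm (sum_n a n) <= B / (1 - q).
Proof.
intros Hq HB Ha.
assert (H : norm (sum_n a n) <= B * (1 - q ^ S n) / (1 - q)).
{ induction n as [|n IH].
  - rewrite sum_O. assert (H := Ha 0%nat).
    replace (B * (1 - q ^ 1) / (1 - q)) with (B * q ^ 0); [exact H|simpl; field; lra].
  - rewrite sum_Sn. apply Rle_trans with (1 := norm_plus_le _ _).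
    assert (H := Ha (S n)).
    replace (B * (1 - q ^ S (S n)) / (1 - q))
      with (B * (1 - q ^ S n) / (1 - q) + B * q ^ S n) by (simpl; field; lra).
    lra. }
apply Rle_trans with (1 := H). unfold Rdiv.
apply Rmult_le_compat_r; [left; apply Rinv_0_lt_compat; lra|].
assert (H1 := pow_le q (S n) (proj1 Hq)).
assert (H2 := Rmult_le_pos _ _ HB H1). lra.
Qed.

(** Boundedness of the orbit of [w] comes from applying the geometric bound to
    every [T^j] of the series. *)
Lemma resolvent_vector_exists (T : X -> X) (s : C) (B : R) (x : X) :
  is_linear T -> Cmod s < 1 -> orbit_le T B x ->
  exists w : X, resolvent_vector T s x w.
Proof.
intros HT Hs Hx.
assert (Hq : 0 <= Cmod s < 1) by (split; [apply Cmod_ge_0 | exact Hs]).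
assert (HB := orbit_le_nonneg T B x Hx).
pose (a := fun k => scal (Cpow s k : C_AbsRing) (Nat.iter k T x)).
assert (Ha : forall j k, norm (Nat.iter j T (a k)) <= B * Cmod s ^ k).
{ intros j k. unfold a. rewrite (linear_scal _ (iter_linear T j HT)).
  apply Rle_trans with (1 := norm_scal_Cmod _ _). rewrite Cmod_pow, Rmult_comm.
  apply Rmult_le_compat_r; [apply pow_le, Hq | apply orbit_le_iter, Hx]. }
destruct (ex_series_le a (fun k => B * Cmod s ^ k) (Ha 0%nat)) as [w Hw].
{ exists (B * / (1 - Cmod s)).
  apply (is_series_scal_l B (fun k => Cmod s ^ k)).
  apply is_series_geom. rewrite Rabs_pos_eq; lra. }
exists w. split.
- exists (B / (1 - Cmod s)). intros j.
  apply norm_le_lim with (u := sum_n (fun k => Nat.iter j T (a k))).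
  + exact (linear_is_series _ _ _ (iter_linear T j HT) Hw).
  + intros n. apply norm_sum_n_geom_le; trivial.
- (* [s T] shifts the series by one term. *)
  pose (sT := fun v => scal s (T v) : X).
  assert (HsT : is_linear sT).
  { apply (is_linear_comp T (fun v : X => scal (s : C_AbsRing) v) HT).
    exact (@is_linear_scal_r C_AbsRing X s Cmult_comm). }
  assert (H1 := linear_is_series sT a w HsT Hw).
  assert (H2 : is_series (fun k => a (S k)) (sT w)).
  { refine (is_series_ext (fun k => sT (a k)) _ _ _ H1). intros k. unfold sT, a.
    rewrite (linear_scal _ HT). cbn [Cpow].
    exact (scal_assoc (s : C_AbsRing) (Cpow s k) (Nat.iter (S k) T x)). }
  replace (sT w) with (plus (plus (sT w) x) (opp (a 0%nat))) in H2.
  2:{ unfold a; cbn [Cpow Nat.iter nat_rect].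
      lin_coefs (sT w :: x :: nil); ring. }
  assert (E : w = plus (sT w) x)
    by exact (filterlim_locally_unique _ _ _ Hw (is_series_decr_1 a _ H2)).
  change (minus w (sT w) = x). rewrite E at 1.
  lin_coefs (sT w :: x :: nil); ring.
Qed.

End Orbits.

(** * Cauchy estimates *)

Lemma Csqrt_exists (z : C) : exists s : C, Cmult s s = z.
Proof.
destruct z as [a b].
assert (Hm := Cmod2_alt (a, b)). set (m := Cmod (a, b)) in *.
unfold Re, Im in Hm; cbn [fst snd] in Hm.
assert (Hm0 : 0 <= m) by apply Cmod_ge_0.
assert (Ha := re_le_Cmod (a, b)). fold m in Ha. unfold Re in Ha; cbn [fst] in Ha.
apply Rabs_le_between in Ha.
assert (Hp : 0 <= (m + a) / 2) by lra. assert (Hn : 0 <= (m - a) / 2) by lra.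
assert (Sp := sqrt_sqrt _ Hp). assert (Sn := sqrt_sqrt _ Hn).
set (u := sqrt ((m + a) / 2)) in *. set (v := sqrt ((m - a) / 2)) in *.
assert (Hu : 0 <= u) by apply sqrt_pos. assert (Hv : 0 <= v) by apply sqrt_pos.
assert (E : (2 * (u * v)) * (2 * (u * v)) = b * b).
{ replace (2 * (u * v) * (2 * (u * v))) with (4 * ((u * u) * (v * v))) by ring.
  rewrite Sp, Sn. lra. }
assert (Huv := Rmult_le_pos _ _ Hu Hv).
destruct (Rle_dec 0 b) as [Hb|Hb].
- exists (u, v). unfold Cmult; cbn [fst snd]. f_equal; [lra|].
  assert (2 * (u * v) = b) by (apply Rsqr_inj; unfold Rsqr; lra). lra.
- exists (u, - v). unfold Cmult; cbn [fst snd]. f_equal; [lra|].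
  assert (2 * (u * v) = - b) by (apply Rsqr_inj; unfold Rsqr; lra). lra.
Qed.

Lemma Csqrt_exists_Cmod (z : C) (q : R) :
  0 <= q -> Cmod z = q * q -> exists s : C, Cmult s s = z /\ Cmod s = q.
Proof.
intros Hq Hz. destruct (Csqrt_exists z) as [s Hs]. exists s. split; [exact Hs|].
apply Rsqr_inj; [apply Cmod_ge_0 | exact Hq |]. unfold Rsqr.
rewrite <- Cmod_mult, Hs. exact Hz.
Qed.

Definition square_op {X : Type} (T : X -> X) : X -> X := fun x => T (T x).

Lemma iter_square_op {X : Type} (T : X -> X) (k : nat) (x : X) :
  Nat.iter k (square_op T) x = Nat.iter (2 * k) T x.
Proof.
induction k as [|k IH]; [reflexivity|].
replace (2 * S k)%nat with (S (S (2 * k))) by lia. simpl Nat.iter at 1.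
rewrite IH. reflexivity.
Qed.

Section Cauchy.
Variable X : CompleteNormedModule C_AbsRing.

Lemma square_op_linear (T : X -> X) : is_linear T -> is_linear (square_op T).
Proof. intros HT. exact (is_linear_comp _ _ HT HT). Qed.

Lemma orbit_le_square_op (T : X -> X) (B : R) (x : X) :
  orbit_le X T B x -> orbit_le X (square_op T) B x.
Proof. intros H k. rewrite iter_square_op. apply H. Qed.

Lemma orbit_bounded_square_op (T : X -> X) (x : X) :
  orbit_bounded X T x -> orbit_bounded X (square_op T) x.
Proof. intros [B H]. exists B. apply orbit_le_square_op, H. Qed.

(** The even part of [sum_k s^k T^k x] is the series of [T^2] at [s^2]. *)
Lemma resolvent_vector_even (T : X -> X) (s : C) (x w w' : X) :
  is_linear T -> resolvent_vector X T s x w -> resolvent_vector X T (Copp s) x w' ->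
  resolvent_vector X (square_op T) (Cmult s s) x
    (plus (scal (Cinv 2) w) (scal (Cinv 2) w')).
Proof.
intros HT [Hw E] [Hw' E']. split.
- apply orbit_bounded_square_op.
  apply orbit_bounded_plus; [exact HT| |]; apply orbit_bounded_scal; trivial.
- assert (E1 : minus (T w) (scal s (T (T w))) = T x)
    by (rewrite <- E; expand_linear HT; reflexivity).
  assert (E2 : minus (T w') (scal (Copp s) (T (T w'))) = T x)
    by (rewrite <- E'; expand_linear HT; reflexivity).
  assert (H2 : RtoC 2 <> 0) by (intros H; apply RtoC_inj in H; lra).
  transitivity (plus (scal (Cinv 2) (plus (minus w (scal s (T w)))
                                  (scal s (minus (T w) (scal s (T (T w)))))))
                     (scal (Cinv 2) (minus (minus w' (scal (Copp s) (T w')))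
                             (scal s (minus (T w') (scal (Copp s) (T (T w')))))))).
  + unfold square_op. expand_linear HT.
    lin_coefs (w :: T w :: T (T w) :: w' :: T w' :: T (T w') :: nil); ring.
  + rewrite E1, E2, E, E'. lin_coefs (x :: T x :: nil); field; exact H2.
Qed.

(** The odd part of [sum_k s^k T^k x], divided by [s], is the series of [T^2]
    and [T x] at [s^2]. *)
Lemma resolvent_vector_odd (T : X -> X) (s : C) (x w w' : X) :
  is_linear T -> s <> 0%C ->
  resolvent_vector X T s x w -> resolvent_vector X T (Copp s) x w' ->
  resolvent_vector X (square_op T) (Cmult s s) (T x)
    (plus (scal (Cinv (2 * s)) w) (scal (Copp (Cinv (2 * s))) w')).
Proof.
intros HT Hs [Hw E] [Hw' E']. split.
- apply orbit_bounded_square_op.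
  apply orbit_bounded_plus; [exact HT| |]; apply orbit_bounded_scal; trivial.
- assert (E1 : minus (T w) (scal s (T (T w))) = T x)
    by (rewrite <- E; expand_linear HT; reflexivity).
  assert (E2 : minus (T w') (scal (Copp s) (T (T w'))) = T x)
    by (rewrite <- E'; expand_linear HT; reflexivity).
  assert (H2 : RtoC 2 <> 0) by (intros H; apply RtoC_inj in H; lra).
  transitivity (plus (scal (Cinv (2 * s)) (plus (minus w (scal s (T w)))
                                  (scal s (minus (T w) (scal s (T (T w)))))))
                     (scal (Copp (Cinv (2 * s)))
                             (minus (minus w' (scal (Copp s) (T w')))
                             (scal s (minus (T w') (scal (Copp s) (T (T w')))))))).
  + unfold square_op. expand_linear HT.
    lin_coefs (w :: T w :: T (T w) :: w' :: T w' :: T (T w') :: nil); ring.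
  + rewrite E1, E2, E, E'. lin_coefs (x :: T x :: nil); field; repeat split; assumption.
Qed.

Definition resolvent_le_on_circle (T : X -> X) (q M : R) (x : X) : Prop :=
  forall s : C, Cmod s = q -> exists w : X, resolvent_vector X T s x w /\ norm w <= M.

Lemma norm_comb_le (a b : C) (x y : X) (M : R) :
  norm x <= M -> norm y <= M ->
  norm (plus (scal a x) (scal b y)) <= (Cmod a + Cmod b) * M.
Proof.
intros Hx Hy. apply Rle_trans with (1 := norm_plus_scal_le X b _ y).
assert (H1 := norm_scal_Cmod X a x).
assert (H2 := Rmult_le_compat_l _ _ _ (Cmod_ge_0 a) Hx).
assert (H3 := Rmult_le_compat_l _ _ _ (Cmod_ge_0 b) Hy). lra.
Qed.

Lemma resolvent_le_on_circle_even (T : X -> X) (q M : R) (x : X) :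
  is_linear T -> 0 <= q -> resolvent_le_on_circle T q M x ->
  resolvent_le_on_circle (square_op T) (q * q) M x.
Proof.
intros HT Hq H z Hz.
destruct (Csqrt_exists_Cmod z q Hq Hz) as [s [<- Hs]].
destruct (H s Hs) as [w [Hw Nw]].
destruct (H (Copp s)) as [w' [Hw' Nw']]; [now rewrite Cmod_opp|].
eexists. split; [apply (resolvent_vector_even T s x w w'); assumption|].
apply Rle_trans with (1 := norm_comb_le _ _ _ _ M Nw Nw').
assert (H2 : Cmod (Cinv 2) = / 2).
{ rewrite Cmod_inv, Cmod_R, Rabs_pos_eq; [reflexivity|lra|].
  intros E; apply RtoC_inj in E; lra. }
rewrite H2. lra.
Qed.

Lemma resolvent_le_on_circle_odd (T : X -> X) (q M : R) (x : X) :
  is_linear T -> 0 < q -> resolvent_le_on_circle T q M x ->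
  resolvent_le_on_circle (square_op T) (q * q) (M / q) (T x).
Proof.
intros HT Hq H z Hz.
destruct (Csqrt_exists_Cmod z q (Rlt_le _ _ Hq) Hz) as [s [<- Hs]].
assert (Hs0 : s <> 0%C) by (apply Cmod_gt_0; rewrite Hs; exact Hq).
destruct (H s Hs) as [w [Hw Nw]].
destruct (H (Copp s)) as [w' [Hw' Nw']]; [now rewrite Cmod_opp|].
eexists. split; [apply (resolvent_vector_odd T s x w w'); assumption|].
apply Rle_trans with (1 := norm_comb_le _ _ _ _ M Nw Nw').
assert (H2 : Cmod (Cinv (2 * s)) = / (2 * q)).
{ rewrite Cmod_inv, Cmod_mult, Cmod_R, Rabs_pos_eq, Hs; [reflexivity|lra|].
  apply Cmult_neq_0; [|exact Hs0]. intros E; apply RtoC_inj in E; lra. }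
rewrite Cmod_opp, H2. right. field. lra.
Qed.

(** Passing to even parts [n] times leaves the series of [T^(2^n)] on the circle
    of radius [q^(2^n)], which tends to its constant term [x]. *)
Lemma cauchy_estimate_0 (T : X -> X) (q B M : R) (x : X) :
  is_linear T -> 0 < q < 1 -> orbit_le X T B x -> resolvent_le_on_circle T q M x ->
  norm x <= M.
Proof.
intros HT Hq Hx H. assert (HB := orbit_le_nonneg X T B x Hx).
apply le_of_geometric_defect with (q := q) (c := B / (1 - q)); [lra| |].
{ apply Rdiv_le_0_compat; lra. }
intros n.
cut (forall p U, 0 < p <= q -> is_linear U -> orbit_le X U B x ->
  resolvent_le_on_circle U p M x -> norm x <= M + p ^ S n * (B / (1 - q))).
{ intros K. apply Rle_trans with (1 := K q T (conj (proj1 Hq) (Rle_refl q)) HT Hx H).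
  apply Rplus_le_compat_l, Rmult_le_compat_r; [apply Rdiv_le_0_compat; lra|].
  simpl. rewrite <- (Rmult_1_l (q ^ n)) at 2.
  apply Rmult_le_compat_r; [apply pow_le|]; lra. }
clear T HT Hx H. induction n as [|n IH]; intros p U Hp HU Hx H.
- destruct (H (RtoC p)) as [w [Hw Nw]].
  { rewrite Cmod_R, Rabs_pos_eq; lra. }
  assert (Ep : Cmod (RtoC p) = p) by (rewrite Cmod_R, Rabs_pos_eq; lra).
  assert (Ow := resolvent_vector_orbit_le X U p B x w HU ltac:(lra) Hx Hw).
  rewrite Ep in Ow. assert (O1 := Ow 1%nat). simpl in O1.
  rewrite <- (proj2 Hw).
  apply Rle_trans with (1 := norm_minus_scal_le X _ _ _).
  rewrite Ep, pow_1.
  apply Rplus_le_compat; [exact Nw|]. apply Rmult_le_compat_l; [lra|].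
  apply Rle_trans with (1 := O1). apply Rmult_le_compat_l; [exact HB|].
  apply Rinv_le_contravar; lra.
- assert (Hpp : p * p <= p) by (rewrite <- (Rmult_1_r p) at 3;
    apply Rmult_le_compat_l; lra).
  apply Rle_trans with (M + (p * p) ^ S n * (B / (1 - q))).
  + apply (IH (p * p) (square_op U)).
    * split; [apply Rmult_lt_0_compat|]; lra.
    * apply square_op_linear, HU.
    * apply orbit_le_square_op, Hx.
    * apply resolvent_le_on_circle_even; [exact HU|lra|exact H].
  + apply Rplus_le_compat_l, Rmult_le_compat_r; [apply Rdiv_le_0_compat; lra|].
    assert (Hn : 0 <= p ^ n <= 1).
    { split; [apply pow_le; lra|]. rewrite <- (pow1 n). apply pow_incr. lra. }
    rewrite Rpow_mult_distr. simpl.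
    replace (p * p ^ n * (p * p ^ n)) with (p * (p * p ^ n) * p ^ n) by ring.
    rewrite <- (Rmult_1_r (p * (p * p ^ n))) at 2.
    apply Rmult_le_compat_l; [|apply Hn].
    repeat apply Rmult_le_pos; try apply Hn; lra.
Qed.

(** Cauchy's inequality for the coefficient [T^m x] of [sum_k s^k T^k x], by
    reading [m] in binary: a last digit 0 or 1 selects the even or the odd part of
    the series. *)
Lemma cauchy_estimate (m : nat) (T : X -> X) (q B M : R) (x : X) :
  is_linear T -> 0 < q < 1 -> orbit_le X T B x -> resolvent_le_on_circle T q M x ->
  q ^ m * norm (Nat.iter m T x) <= M.
Proof.
revert T q M x. induction m as [m IH] using (well_founded_induction Nat.lt_wf_0). intros T q M x HT Hq Hx H.
destruct (Nat.eq_dec m 0) as [->|Hm].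
{ simpl. rewrite Rmult_1_l. exact (cauchy_estimate_0 T q B M x HT Hq Hx H). }
assert (Hqq : 0 < q * q < 1).
{ split; [apply Rmult_lt_0_compat; lra|]. rewrite <- (Rmult_1_r 1).
  apply Rmult_le_0_lt_compat; lra. }
destruct (Nat.Even_or_Odd m) as [[k ->]|[k ->]].
- rewrite pow_mult, <- iter_square_op. replace (q ^ 2) with (q * q) by ring.
  apply IH; [lia|apply square_op_linear, HT|exact Hqq|apply orbit_le_square_op, Hx|].
  apply resolvent_le_on_circle_even; [exact HT|lra|exact H].
- rewrite Nat.add_1_r, Nat.iter_succ_r, <- iter_square_op.
  assert (K : (q * q) ^ k * norm (Nat.iter k (square_op T) (T x)) <= M / q).
  { apply IH; [lia|apply square_op_linear, HT|exact Hqq| |].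
    - apply orbit_le_square_op, (orbit_le_iter X T B x 1), Hx.
    - apply resolvent_le_on_circle_odd; [exact HT|lra|exact H]. }
  apply (Rmult_le_compat_l q) in K; [|lra].
  replace (q * (M / q)) with M in K by (field; lra).
  apply Rle_trans with (2 := K). right.
  change (q ^ S (2 * k)) with (q * q ^ (2 * k)). rewrite pow_mult.
  replace (q ^ 2) with (q * q) by ring. ring.
Qed.

End Cauchy.

(** * The maximum principle *)

Section MaximumPrinciple.
Variable X : CompleteNormedModule C_AbsRing.
Variable T : X -> X.
Hypothesis HT : is_linear T.

Lemma orbit_le_scal_T (B : R) (c : C) (x : X) :
  orbit_le X T B x -> orbit_le X T (Cmod c * B) (scal c (T x)).
Proof.
intros Hx k. rewrite (linear_scal _ (iter_linear X T k HT)), <- Nat.iter_succ_r.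
apply Rle_trans with (1 := norm_scal_Cmod X _ _).
apply Rmult_le_compat_l; [apply Cmod_ge_0 | apply Hx].
Qed.

Lemma taylor_error_orbit_le (s h : C) (q B : R) (f e : X) :
  Cmod s <= q < 1 -> orbit_le X T B f -> resolvent_vector X T s (scal h (T f)) e ->
  orbit_le X T (Cmod h * B / (1 - q)) e.
Proof.
intros Hs Hf He. assert (HB := orbit_le_nonneg X T B f Hf).
apply orbit_le_weaken with (Cmod h * B / (1 - Cmod s)).
- apply Rmult_le_compat_l; [apply Rmult_le_pos; [apply Cmod_ge_0|exact HB]|].
  apply Rinv_le_contravar; lra.
- apply (resolvent_vector_orbit_le X T s _ (scal h (T f))); trivial; [lra|].
  apply orbit_le_scal_T, Hf.
Qed.

(** The identity [w - y = h (1 - s T)^-1 T w] between the solutions at [s + h] and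
    at [s]. Its two sides are compared through the equation they solve, so it
    remains meaningful where [1 - s T] is not injective. *)
Lemma resolvent_identity (s h : C) (x y w : X) :
  resolvent_vector X T s x y -> resolvent_vector X T (Cplus s h) x w ->
  resolvent_vector X T s (scal h (T w)) (minus w y).
Proof.
intros [By Ey] [Bw Ew]. split; [apply orbit_bounded_minus; trivial|].
transitivity (plus (minus w (scal (Cplus s h) (T w)))
                (minus (scal h (T w)) (minus y (scal s (T y))))).
- expand_linear HT. lin_coefs (w :: T w :: y :: T y :: nil); ring.
- rewrite Ew, Ey. lin_coefs (x :: T w :: nil); ring.
Qed.

(** If [e] is the error of a Taylor polynomial of [s |-> (1 - s T)^-1 x] and [f]
    that of the preceding one, then [e = h (1 - s T)^-1 T f]. Subtracting one more
    term of the expansion preserves this relation. *)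
Lemma taylor_error_step (s h c : C) (f e y y' : X) :
  resolvent_vector X T s (scal h (T f)) e -> resolvent_vector X T s (T y) y' ->
  resolvent_vector X T s (scal h (T (minus f (scal c y))))
    (minus e (scal (Cmult h c) y')).
Proof.
intros [Be Ee] [By Ey]. split.
- apply orbit_bounded_minus; [exact HT|exact Be|].
  apply orbit_bounded_scal; trivial.
- transitivity (minus (minus e (scal s (T e)))
                  (scal (Cmult h c) (minus y' (scal s (T y'))))).
  + expand_linear HT. lin_coefs (e :: T e :: y' :: T y' :: nil); ring.
  + rewrite Ee, Ey. expand_linear HT. lin_coefs (T f :: T y :: nil); ring.
Qed.

Definition quadratic_taylor (y y1 y2 : X) (h : C) : X :=
  plus y (plus (scal h y1) (scal (Cmult h h) y2)).

Lemma resolvent_vector_taylor (s h : C) (q B : R) (x y y1 y2 w : X) :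
  Cmod s <= q -> Cmod (Cplus s h) <= q -> q < 1 -> orbit_le X T B x ->
  resolvent_vector X T s x y -> resolvent_vector X T s (T y) y1 ->
  resolvent_vector X T s (T y1) y2 -> resolvent_vector X T (Cplus s h) x w ->
  norm (minus w (quadratic_taylor y y1 y2 h)) <= Cmod h ^ 3 * (B / (1 - q) ^ 4).
Proof.
intros Hs Hsh Hq Hx Hy Hy1 Hy2 Hw.
assert (Ow : orbit_le X T (B / (1 - q)) w).
{ apply orbit_le_weaken with (B / (1 - Cmod (Cplus s h))).
  - apply Rmult_le_compat_l; [exact (orbit_le_nonneg X T B x Hx)|].
    apply Rinv_le_contravar; lra.
  - apply (resolvent_vector_orbit_le X T (Cplus s h) B x); trivial. lra. }
assert (Hsq := conj Hs Hq).
assert (R0 := resolvent_identity s h x y w Hy Hw).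
assert (O0 := taylor_error_orbit_le s h q _ _ _ Hsq Ow R0).
assert (R1 := taylor_error_step s h (RtoC 1) w (minus w y) y y1 R0 Hy1).
replace (minus w (scal (RtoC 1) y)) with (minus w y) in R1
  by (lin_coefs (w :: y :: nil); ring).
assert (O1 := taylor_error_orbit_le s h q _ _ _ Hsq O0 R1).
assert (R2 := taylor_error_step s h h (minus w y) _ y1 y2 R1 Hy2).
replace (minus (minus w y) (scal h y1))
  with (minus (minus w y) (scal (Cmult h 1) y1)) in R2
  by (lin_coefs (w :: y :: y1 :: nil); ring).
assert (O2 := taylor_error_orbit_le s h q _ _ _ Hsq O1 R2).
apply orbit_le_0 in O2.
replace (minus w (quadratic_taylor y y1 y2 h))
  with (minus (minus (minus w y) (scal (Cmult h 1) y1)) (scal (Cmult h h) y2))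
  by (unfold quadratic_taylor; lin_coefs (w :: y :: y1 :: y2 :: nil); ring).
apply Rle_trans with (1 := O2). right. field. lra.
Qed.

Lemma quadratic_taylor_four_points (y y1 y2 : X) (h : C) :
  plus (plus (quadratic_taylor y y1 y2 h) (quadratic_taylor y y1 y2 (Cmult Ci h)))
    (plus (quadratic_taylor y y1 y2 (Copp h))
          (quadratic_taylor y y1 y2 (Copp (Cmult Ci h)))) = scal (RtoC 4) y.
Proof.
assert (Hi : Cmult Ci Ci = Copp 1) by (apply injective_projections; simpl; ring).
unfold quadratic_taylor. lin_coefs (y :: y1 :: y2 :: nil); try ring.
transitivity (2 * (1 + Ci * Ci) * (h * h))%C; [ring|rewrite Hi; ring].
Qed.

Lemma norm_scal_4 (y : X) : norm (scal (RtoC 4) y) = 4 * norm y.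
Proof.
apply Rle_antisym.
- apply Rle_trans with (1 := norm_scal_Cmod X _ _).
  rewrite Cmod_R, Rabs_pos_eq; lra.
- assert (H : norm y <= / 4 * norm (scal (RtoC 4) y)).
  { replace y with (scal (RtoC (/ 4)) (scal (RtoC 4) y)) at 1.
    - apply Rle_trans with (1 := norm_scal_Cmod X _ _).
      rewrite Cmod_R, Rabs_pos_eq; lra.
    - lin_coefs (y :: nil). apply injective_projections; simpl; field. }
  lra.
Qed.

(** Over the directions [1, i, -1, -i] the linear and the quadratic terms average
    to zero: this approximate mean value property is what subharmonicity of
    [norm ((1 - s T)^-1 x)] amounts to here. *)
Lemma four_point_mean_value (s h : C) (q B : R) (x y w1 w2 w3 w4 : X) :
  Cmod s <= q -> q < 1 -> orbit_le X T B x ->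
  Cmod (Cplus s h) <= q -> Cmod (Cplus s (Cmult Ci h)) <= q ->
  Cmod (Cplus s (Copp h)) <= q -> Cmod (Cplus s (Copp (Cmult Ci h))) <= q ->
  resolvent_vector X T s x y ->
  resolvent_vector X T (Cplus s h) x w1 ->
  resolvent_vector X T (Cplus s (Cmult Ci h)) x w2 ->
  resolvent_vector X T (Cplus s (Copp h)) x w3 ->
  resolvent_vector X T (Cplus s (Copp (Cmult Ci h))) x w4 ->
  4 * norm y <= norm w1 + norm w2 + norm w3 + norm w4
                + 4 * (Cmod h ^ 3 * (B / (1 - q) ^ 4)).
Proof.
intros Hs Hq Hx H1 H2 H3 H4 Hy W1 W2 W3 W4.
assert (Hs1 : Cmod s < 1) by lra.
assert (Oy := resolvent_vector_orbit_le X T s B x y HT Hs1 Hx Hy).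
destruct (resolvent_vector_exists X T s _ (T y) HT Hs1 (orbit_le_iter X T _ y 1 Oy))
  as [y1 Hy1].
assert (Oy1 := resolvent_vector_orbit_le X T s _ _ y1 HT Hs1
  (orbit_le_iter X T _ y 1 Oy) Hy1).
destruct (resolvent_vector_exists X T s _ (T y1) HT Hs1 (orbit_le_iter X T _ y1 1 Oy1))
  as [y2 Hy2].
assert (E1 := resolvent_vector_taylor s _ q B x y y1 y2 w1 Hs H1 Hq Hx Hy Hy1 Hy2 W1).
assert (E2 := resolvent_vector_taylor s _ q B x y y1 y2 w2 Hs H2 Hq Hx Hy Hy1 Hy2 W2).
assert (E3 := resolvent_vector_taylor s _ q B x y y1 y2 w3 Hs H3 Hq Hx Hy Hy1 Hy2 W3).
assert (E4 := resolvent_vector_taylor s _ q B x y y1 y2 w4 Hs H4 Hq Hx Hy Hy1 Hy2 W4).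
rewrite Cmod_mult, Cmod_Ci, Rmult_1_l in E2.
rewrite Cmod_opp in E3.
rewrite Cmod_opp, Cmod_mult, Cmod_Ci, Rmult_1_l in E4.
rewrite <- norm_scal_4, <- (quadratic_taylor_four_points y y1 y2 h).
assert (P : forall w p : X, norm p <= norm w + norm (minus w p)).
{ intros w p. replace p with (minus w (minus w p)) at 1
    by (lin_coefs (w :: p :: nil); ring).
  apply (norm_minus_le C_AbsRing X). }
assert (P1 := P w1 (quadratic_taylor y y1 y2 h)).
assert (P2 := P w2 (quadratic_taylor y y1 y2 (Cmult Ci h))).
assert (P3 := P w3 (quadratic_taylor y y1 y2 (Copp h))).
assert (P4 := P w4 (quadratic_taylor y y1 y2 (Copp (Cmult Ci h)))).
apply Rle_trans with (1 := norm_plus_le X _ _).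
assert (Q1 := norm_plus_le X (quadratic_taylor y y1 y2 h)
  (quadratic_taylor y y1 y2 (Cmult Ci h))).
assert (Q2 := norm_plus_le X (quadratic_taylor y y1 y2 (Copp h))
  (quadratic_taylor y y1 y2 (Copp (Cmult Ci h)))).
lra.
Qed.

Lemma Cmod2_four_points (s h : C) :
  Cmod (Cplus s h) ^ 2 + Cmod (Cplus s (Cmult Ci h)) ^ 2
  + Cmod (Cplus s (Copp h)) ^ 2 + Cmod (Cplus s (Copp (Cmult Ci h))) ^ 2
  = 4 * (Cmod s ^ 2 + Cmod h ^ 2).
Proof. rewrite !Cmod2_alt. destruct s, h. simpl. ring. Qed.

(** The strictly subharmonic perturbation [norm w + eta |s|^2] gains [eta h^2]
    over its mean on a circle of radius [h], more than the mean value property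
    loses, so a point where it is within [eta h^2 / 2] of its supremum over [K]
    lies close to the boundary of [K]. No such supremum needs to be attained, and
    [K] may be any bounded set. *)
Lemma maximum_principle (K : C -> Prop) (q h0 B M : R) (x : X) :
  q < 1 -> 0 < h0 -> orbit_le X T B x ->
  (forall s, K s -> Cmod s <= q) ->
  (forall s, K s -> (forall h, Cmod h <= h0 -> K (Cplus s h)) \/
     (forall w, resolvent_vector X T s x w -> norm w <= M)) ->
  forall s w, K s -> resolvent_vector X T s x w -> norm w <= M.
Proof.
intros Hq Hh0 Hx HK Hbd s0 w0 Ks0 Hw0. apply Rnot_lt_le. intros Hlt.
assert (HB := orbit_le_nonneg X T B x Hx).
set (eta := (norm w0 - M) / 2). assert (Heta : 0 < eta) by (unfold eta; lra).
assert (Hsmall : forall s, K s -> Cmod s ^ 2 <= 1).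
{ intros s Ks. assert (H := HK s Ks). assert (H' := Cmod_ge_0 s).
  rewrite <- (pow1 2). apply pow_incr. lra. }
set (V := fun v : R => exists s w, K s /\ resolvent_vector X T s x w /\
  v = norm w + eta * Cmod s ^ 2).
destruct (completeness V) as [m [Hub Hleast]].
{ exists (B / (1 - q) + eta). intros v (s & w & Ks & Hw & ->).
  assert (Hs := HK s Ks).
  assert (H1 := orbit_le_0 X T _ w
    (resolvent_vector_orbit_le X T s B x w HT (Rle_lt_trans _ _ _ Hs Hq) Hx Hw)).
  assert (H2 : B / (1 - Cmod s) <= B / (1 - q)).
  { apply Rmult_le_compat_l; [exact HB|]. apply Rinv_le_contravar; lra. }
  assert (H3 := Rmult_le_compat_l eta _ _ (Rlt_le _ _ Heta) (Hsmall s Ks)). lra. }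
{ eexists. exists s0, w0. repeat split; try eassumption; apply Hw0. }
assert (Hm : norm w0 <= m).
{ apply Rle_trans with (norm w0 + eta * Cmod s0 ^ 2).
  - assert (H := Rmult_le_pos _ _ (Rlt_le _ _ Heta) (pow2_ge_0 (Cmod s0))). lra.
  - apply Hub. exists s0, w0. auto. }
set (E := B / (1 - q) ^ 4).
assert (HE : 0 <= E).
{ apply Rdiv_le_0_compat; [exact HB|]. apply pow_lt; lra. }
(* The third bound makes the cubic error at most half of the quadratic gain. *)
set (h := Rmin h0 (Rmin 1 (eta / (2 * (E + 1))))).
assert (He : 0 < eta / (2 * (E + 1))) by (apply Rdiv_lt_0_compat; lra).
assert (Hh : 0 < h) by (unfold h; repeat apply Rmin_glb_lt; lra).
assert (Hh1 : h <= h0) by apply Rmin_l.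
assert (Hh2 : h <= 1) by (eapply Rle_trans; [apply Rmin_r|apply Rmin_l]).
assert (Hh3 : h * (2 * (E + 1)) <= eta).
{ assert (H : h <= eta / (2 * (E + 1)))
    by (eapply Rle_trans; [apply Rmin_r|apply Rmin_r]).
  apply (Rmult_le_compat_r (2 * (E + 1))) in H; [|lra].
  replace (eta / (2 * (E + 1)) * (2 * (E + 1))) with eta in H by (field; lra).
  exact H. }
assert (Hhh : 0 < h * h) by (apply Rmult_lt_0_compat; lra).
assert (Hgain : 0 < eta * (h * h)) by (apply Rmult_lt_0_compat; lra).
assert (Hnear : exists s w, K s /\ resolvent_vector X T s x w /\
  m - eta * (h * h) / 2 < norm w + eta * Cmod s ^ 2).
{ apply NNPP. intros Hn.
  assert (H : m <= m - eta * (h * h) / 2); [|lra].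
  apply Hleast. intros v (s & w & Ks & Hw & ->). apply Rnot_lt_le. intros H.
  apply Hn. exists s, w. auto. }
destruct Hnear as (s & w & Ks & Hw & Hsw).
assert (Hhh1 : h * h <= 1).
{ rewrite <- (Rmult_1_r 1). apply Rmult_le_compat; lra. }
assert (Hgain1 : eta * (h * h) <= eta).
{ rewrite <- (Rmult_1_r eta) at 2. apply Rmult_le_compat_l; lra. }
destruct (Hbd s Ks) as [Hin|HM].
2:{ assert (H := HM w Hw).
    assert (H3 := Rmult_le_compat_l eta _ _ (Rlt_le _ _ Heta) (Hsmall s Ks)).
    unfold eta in *. lra. }
assert (Hc : Cmod h = h) by (rewrite Cmod_R, Rabs_pos_eq; lra).
assert (Hpt : forall c : C, Cmod c = h -> Cmod (Cplus s c) <= q /\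
  exists v, resolvent_vector X T (Cplus s c) x v /\
    norm v + eta * Cmod (Cplus s c) ^ 2 <= m).
{ intros c Ec. assert (Kc : K (Cplus s c)) by (apply Hin; lra).
  assert (Hsc := HK _ Kc). split; [exact Hsc|].
  destruct (resolvent_vector_exists X T (Cplus s c) B x HT
    (Rle_lt_trans _ _ _ Hsc Hq) Hx) as [v Hv].
  exists v. split; [exact Hv|]. apply Hub. exists (Cplus s c), v. auto. }
destruct (Hpt h Hc) as (C1 & w1 & W1 & N1).
destruct (Hpt (Cmult Ci h)) as (C2 & w2 & W2 & N2);
  [rewrite Cmod_mult, Cmod_Ci, Hc; ring|].
destruct (Hpt (Copp h)) as (C3 & w3 & W3 & N3); [now rewrite Cmod_opp|].
destruct (Hpt (Copp (Cmult Ci h))) as (C4 & w4 & W4 & N4);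
  [rewrite Cmod_opp, Cmod_mult, Cmod_Ci, Hc; ring|].
assert (Hmv := four_point_mean_value s h q B x w w1 w2 w3 w4 (HK s Ks) Hq Hx
  C1 C2 C3 C4 Hw W1 W2 W3 W4).
assert (Hpar := Cmod2_four_points s h). rewrite Hc in Hmv, Hpar. fold E in Hmv.
assert (Hcube : h ^ 3 * E <= eta * (h * h) / 2).
{ replace (h ^ 3 * E) with (h * h * (h * E)) by ring.
  replace (eta * (h * h) / 2) with (h * h * (eta / 2)) by field.
  apply Rmult_le_compat_l; lra. }
apply (f_equal (Rmult eta)) in Hpar.
replace (h ^ 2) with (h * h) in Hpar by ring.
lra.
Qed.

End MaximumPrinciple.

(** * Uniform margins on the closed unit disc *)

(** Closedness spelled out with [Cmod], independently of the choice of a uniform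
    structure on the plane. *)
Definition metric_closed (F : C -> Prop) : Prop :=
  forall z : C, ~ F z ->
    exists e : R, 0 < e /\ forall z' : C, Cmod (Cminus z' z) < e -> ~ F z'.

Lemma Cmod_triangle_minus (z z' : C) : Cmod z <= Cmod z' + Cmod (Cminus z' z).
Proof.
replace z with (Cplus z' (Copp (Cminus z' z))) at 1 by ring.
apply Rle_trans with (1 := Cmod_triangle _ _). rewrite Cmod_opp. apply Rle_refl.
Qed.

Lemma Cmod_minus_sym (z z' : C) : Cmod (Cminus z z') = Cmod (Cminus z' z).
Proof. rewrite <- Cmod_opp. f_equal. ring. Qed.

Lemma Cmod_lt_of_parts (z z' : C) (e : R) :
  Rabs (fst z - fst z') < e / 2 -> Rabs (snd z - snd z') < e / 2 ->
  Cmod (Cminus z z') < e.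
Proof.
intros H1 H2. destruct z as [x y], z' as [x' y']. cbn [fst snd] in *.
replace (Cminus (x, y) (x', y'))
  with (Cplus (RtoC (x - x')) (Cmult Ci (RtoC (y - y'))))
  by (apply injective_projections; simpl; ring).
apply Rle_lt_trans with (1 := Cmod_triangle _ _).
rewrite Cmod_mult, Cmod_Ci, !Cmod_R. lra.
Qed.

(** The Heine-Borel theorem, for a condition with a parameter to be made uniform. *)
Lemma uniform_on_disc (Q : C -> R -> Prop) :
  (forall s e e', Q s e -> 0 < e' <= e -> Q s e') ->
  (forall s, exists e, 0 < e /\ forall s', Cmod (Cminus s' s) < e -> Q s' e) ->
  exists d, 0 < d /\ forall s, Cmod s <= 1 -> Q s d.
Proof.
intros Hmono Hloc.
assert (Hch : forall s : C, {e : R | 0 < e /\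
  forall s', Cmod (Cminus s' s) < e -> Q s' e}).
{ intros s. apply constructive_indefinite_description, Hloc. }
assert (Hpos : forall u v, 0 < proj1_sig (Hch (u, v)) / 2).
{ intros u v. destruct (proj2_sig (Hch (u, v))) as [H _]. lra. }
destruct (compactness_value_2d (-1) 1 (-1) 1
  (fun u v => mkposreal _ (Hpos u v))) as [d Hd].
exists d. split; [apply cond_pos|]. intros s Hs.
assert (Hparts := Rmax_Cmod s).
assert (H1 : Rabs (fst s) <= 1)
  by (assert (H := Rmax_l (Rabs (fst s)) (Rabs (snd s))); lra).
assert (H2 : Rabs (snd s) <= 1)
  by (assert (H := Rmax_r (Rabs (fst s)) (Rabs (snd s))); lra).
apply Rabs_le_between in H1, H2.
apply NNPP. intros HQ. apply (Hd (fst s) (snd s) H1 H2).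
intros (u & v & _ & _ & Hu & Hv & Hle). apply HQ. simpl in Hu, Hv, Hle.
assert (Hp := Hpos u v).
destruct (Hch (u, v)) as [e [He Hball]]. simpl in *.
apply Hmono with e; [|split; [apply cond_pos | lra]].
apply Hball. apply Cmod_lt_of_parts; assumption.
Qed.

(** The third hypothesis is a Lipschitz condition: [P s e] will say that a quantity
    varying with [s] at speed at most one is at least [e]. *)
Lemma uniform_margin (F : C -> Prop) (P : C -> R -> Prop) :
  metric_closed F ->
  (forall s e e', P s e -> 0 < e' <= e -> P s e') ->
  (forall s s' e, 0 < e -> P s (2 * e) -> Cmod (Cminus s' s) < e -> P s' e) ->
  (forall s, F s -> exists e, 0 < e /\ P s e) ->
  exists d, 0 < d /\ forall s, Cmod s <= 1 -> F s -> P s d.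
Proof.
intros HF Hmono Hlip Hpos.
apply (uniform_on_disc (fun s e => F s -> P s e)).
- intros s e e' H He Fs. exact (Hmono s e e' (H Fs) He).
- intros s. destruct (classic (F s)) as [Fs|Fs].
  + destruct (Hpos s Fs) as [e [He Ps]]. exists (e / 2). split; [lra|].
    intros s' Hs' _. apply (Hlip s); [lra| |exact Hs'].
    replace (2 * (e / 2)) with e by field. exact Ps.
  + destruct (HF s Fs) as [e [He Hn]]. exists e. split; [exact He|].
    intros s' Hs' Fs'. destruct (Hn s' Hs' Fs').
Qed.

(** * Points where [1 - s T] is bounded below *)

Section Separation.
Variable X : CompleteNormedModule C_AbsRing.
Variable T : X -> X.
Hypothesis HT : is_linear T.

Definition bounded_below (s : C) (c : R) : Prop :=
  forall w : X, c * norm w <= norm (minus w (scal s (T w))).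

(** The inverses of the nonzero approximate eigenvalues of [T]. They form a closed
    set simply because a lower bound survives a small perturbation. *)
Definition singular_point (s : C) : Prop :=
  ~ exists c : R, 0 < c /\ bounded_below s c.

Lemma bounded_below_perturb (N : R) (s s' : C) (e : R) :
  0 < N -> (forall x, norm (T x) <= N * norm x) -> 0 < e ->
  bounded_below s ((2 * e) * (N + 1)) -> Cmod (Cminus s' s) < e ->
  bounded_below s' (e * (N + 1)).
Proof.
intros HN HTN He Hs Hss w. assert (Hw := Hs w).
assert (H : norm (minus w (scal s (T w))) <=
            norm (minus w (scal s' (T w))) + e * (N * norm w)).
{ replace (minus w (scal s (T w)))
    with (plus (minus w (scal s' (T w))) (scal (Cminus s' s) (T w)))
    by (lin_coefs (w :: T w :: nil); ring).
  apply Rle_trans with (1 := norm_plus_scal_le X _ _ _).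
  apply Rplus_le_compat_l.
  apply Rmult_le_compat; [apply Cmod_ge_0|apply norm_ge_0|lra|apply HTN]. }
assert (H0 : 0 <= e * norm w).
{ apply Rmult_le_pos; [lra|apply norm_ge_0]. }
lra.
Qed.

Lemma bounded_below_margin (F : C -> Prop) :
  metric_closed F -> (forall s, F s -> ~ singular_point s) ->
  exists c, 0 < c /\ forall s, Cmod s <= 1 -> F s -> bounded_below s c.
Proof.
intros HF Hreg. destruct (linear_norm _ HT) as [N [HN HTN]].
destruct (uniform_margin F (fun s e => bounded_below s (e * (N + 1))) HF)
  as [d [Hd HP]].
- intros s e e' H He w. apply Rle_trans with (2 := H w).
  apply Rmult_le_compat_r; [apply norm_ge_0|].
  apply Rmult_le_compat_r; lra.
- intros s s' e He Hs Hss. exact (bounded_below_perturb N s s' e HN HTN He Hs Hss).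
- intros s Fs. destruct (NNPP _ (Hreg s Fs)) as [c [Hc Hb]].
  exists (c / (N + 1)). split; [apply Rdiv_lt_0_compat; lra|].
  replace (c / (N + 1) * (N + 1)) with c by (field; lra). exact Hb.
- exists (d * (N + 1)). split; [apply Rmult_lt_0_compat; lra|exact HP].
Qed.

Lemma singular_point_closed : metric_closed singular_point.
Proof.
intros s Hs. destruct (NNPP _ Hs) as [c [Hc Hb]].
destruct (linear_norm _ HT) as [N [HN HTN]].
set (e := c / (2 * (N + 1))).
assert (He : 0 < e) by (unfold e; apply Rdiv_lt_0_compat; lra).
exists e. split; [exact He|]. intros s' Hs' Hsing. apply Hsing.
exists (e * (N + 1)). split; [apply Rmult_lt_0_compat; lra|].
apply (bounded_below_perturb N s s' e HN HTN He); [|exact Hs'].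
replace (2 * e * (N + 1)) with c by (unfold e; field; lra). exact Hb.
Qed.

Lemma bounded_below_resolvent_le (s : C) (c : R) (x w : X) :
  0 < c -> bounded_below s c -> resolvent_vector X T s x w -> norm w <= norm x / c.
Proof.
intros Hc Hb [_ E]. assert (H := Hb w). rewrite E in H.
apply Rmult_le_reg_l with c; [exact Hc|].
replace (c * (norm x / c)) with (norm x) by (field; lra). exact H.
Qed.

(** The singular points in [F2] are harmless for a vector with a bounded orbit: by
    the maximum principle its resolvent is no larger around them than on the
    boundary of a neighbourhood of [F2], where [1 - s T] is bounded below. The
    resulting disc, being of radius [q > 1 / r], gives a growth of the orbit
    slower than [r^m]. *)
Lemma SDCC_no_separation (r : R) (F1 F2 : C -> Prop) :
  SDCC T r -> metric_closed F1 -> metric_closed F2 ->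
  (forall s, ~ (F1 s /\ F2 s)) ->
  (forall s, F1 s -> / r < Cmod s) -> (forall s, F2 s -> Cmod s < 1) ->
  (forall s, singular_point s -> F1 s \/ F2 s) -> False.
Proof.
intros [Hr Hsdcc] C1 C2 Hdisj HF1 HF2 Hcov.
assert (Hr0 : 0 < / r) by (apply Rinv_0_lt_compat; lra).
assert (Hr1 : / r < 1) by (rewrite <- Rinv_1; apply Rinv_lt_contravar; lra).
destruct (uniform_margin F1 (fun s e => e <= Cmod s - / r) C1) as [d1 [Hd1 M1]].
{ intros; lra. }
{ intros s s' e He H Hs. assert (K := Cmod_triangle_minus s s'). lra. }
{ intros s Fs. exists (Cmod s - / r). assert (K := HF1 s Fs). lra. }
destruct (uniform_margin F2 (fun s e => e <= 1 - Cmod s) C2) as [d2 [Hd2 M2]].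
{ intros; lra. }
{ intros s s' e He H Hs. rewrite Cmod_minus_sym in Hs.
  assert (K := Cmod_triangle_minus s' s). lra. }
{ intros s Fs. exists (1 - Cmod s). assert (K := HF2 s Fs). lra. }
destruct (uniform_margin F2 (fun s e => forall b, F1 b -> e <= Cmod (Cminus b s)) C2)
  as [d3 [Hd3 M3]].
{ intros s e e' H He b Fb. assert (K := H b Fb). lra. }
{ intros s s' e He H Hs b Fb. assert (K := H b Fb).
  assert (K' := Cmod_triangle (Cminus b s') (Cminus s' s)).
  replace (Cplus (Cminus b s') (Cminus s' s)) with (Cminus b s) in K' by ring. lra. }
{ intros s Fs. destruct (C1 s (fun F => Hdisj s (conj F Fs))) as [e [He Hn]].
  exists e. split; [exact He|]. intros b Fb. apply Rnot_lt_le. intros Hlt.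
  exact (Hn b Hlt Fb). }
set (d := Rmin (Rmin d1 d2) (Rmin d3 (1 - / r))).
assert (Hd : 0 < d) by (unfold d; repeat apply Rmin_glb_lt; lra).
assert (Hdd1 : d <= d1) by (eapply Rle_trans; [apply Rmin_l|apply Rmin_l]).
assert (Hdd2 : d <= d2) by (eapply Rle_trans; [apply Rmin_l|apply Rmin_r]).
assert (Hdd3 : d <= d3) by (eapply Rle_trans; [apply Rmin_r|apply Rmin_l]).
assert (Hdr : d <= 1 - / r) by (eapply Rle_trans; [apply Rmin_r|apply Rmin_r]).
clearbody d.
set (q := / r + d / 2).
(* A point of [K] whose neighbourhood of radius [d / 4] leaves [K] is at distance at
   least [d / 4] from [F1] and [F2]; [d <= d3] keeps the neighbourhood of [F2] away from
   [F1], [d <= d2] keeps it inside the unit disc. *)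
set (K := fun s : C => Cmod s <= q \/ exists b, F2 b /\ Cmod (Cminus b s) < d / 2).
set (far := fun s : C => forall b, F1 b \/ F2 b -> d / 4 <= Cmod (Cminus b s)).
assert (HKq : forall s, K s -> Cmod s <= 1 - d / 2).
{ intros s [Hs|[b [Fb Hb]]]; [unfold q in Hs; lra|].
  assert (H := M2 b (Rlt_le _ _ (HF2 b Fb)) Fb).
  assert (H' := Cmod_triangle_minus s b). lra. }
assert (Cfar : metric_closed far).
{ intros s Hs. apply not_all_ex_not in Hs. destruct Hs as [b Hs].
  apply imply_to_and in Hs. destruct Hs as [Fb Hb]. apply Rnot_le_lt in Hb.
  exists (d / 4 - Cmod (Cminus b s)). split; [lra|]. intros s' Hs' Hfar.
  assert (H := Hfar b Fb).
  assert (H' := Cmod_triangle (Cminus b s) (Cminus s s')).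
  replace (Cplus (Cminus b s) (Cminus s s')) with (Cminus b s') in H' by ring.
  rewrite (Cmod_minus_sym s s') in H'. lra. }
destruct (bounded_below_margin far Cfar) as [c [Hc Hbb]].
{ intros s Hs Hsing. assert (H := Hs s (Hcov s Hsing)).
  replace (Cminus s s) with (RtoC 0) in H by ring. rewrite Cmod_0 in H. lra. }
assert (Hint : forall s, K s ->
  (forall h, Cmod h <= d / 4 -> K (Cplus s h)) \/ far s).
{ intros s Ks.
  destruct (classic (exists b, F2 b /\ Cmod (Cminus b s) < d / 4)) as [[b [Fb Hb]]|Hn2].
  { left. intros h Hh. right. exists b. split; [exact Fb|].
    replace (Cminus b (Cplus s h)) with (Cplus (Cminus b s) (Copp h)) by ring.
    apply Rle_lt_trans with (1 := Cmod_triangle _ _). rewrite Cmod_opp. lra. }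
  destruct (Rle_dec (Cmod s) (/ r + d / 4)) as [Hs|Hs].
  { left. intros h Hh. left. apply Rle_trans with (1 := Cmod_triangle _ _).
    unfold q. lra. }
  right. intros b [Fb|Fb].
  2:{ apply Rnot_lt_le. intros Hlt. apply Hn2. exists b. auto. }
  assert (Hb : / r + d <= Cmod b).
  { destruct (Rle_dec (Cmod b) 1) as [Hb1|Hb1]; [|lra].
    assert (H := M1 b Hb1 Fb). lra. }
  destruct Ks as [Ks|[b' [Fb' Hb']]].
  - unfold q in Ks. rewrite Cmod_minus_sym.
    assert (H := Cmod_triangle_minus b s). lra.
  - assert (H := M3 b' (Rlt_le _ _ (HF2 b' Fb')) Fb' b Fb).
    assert (H' := Cmod_triangle (Cminus b s) (Cminus s b')).
    replace (Cplus (Cminus b s) (Cminus s b')) with (Cminus b b') in H' by ring.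
    rewrite (Cmod_minus_sym s b') in H'. lra. }
assert (Hgrow : forall m, (1 <= m)%nat -> (q * r) ^ m <= / c).
{ intros m Hm. destruct (Hsdcc m Hm) as (x & Hx0 & Hlim & Hlow).
  assert (Hnx : 0 < norm x).
  { destruct (norm_ge_0 x) as [H|H]; [exact H|].
    destruct Hx0. apply (@norm_eq_zero C_AbsRing X). symmetry. exact H. }
  destruct (filterlim_bounded (fun k => norm (Nat.iter k T x))) as [B HB].
  { exists 0. exact Hlim. }
  assert (Hx : orbit_le X T B x).
  { intros k. apply Rle_trans with (2 := HB k). apply Rle_abs. }
  assert (Hmax := maximum_principle X T HT K (1 - d / 2) (d / 4) B (norm x / c) x
    ltac:(lra) ltac:(lra) Hx HKq).
  assert (Hcirc : resolvent_le_on_circle X T q (norm x / c) x).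
  { intros s Hs. assert (Ks : K s) by (left; lra).
    assert (Hs1 : Cmod s < 1) by (assert (H := HKq s Ks); lra).
    destruct (resolvent_vector_exists X T s B x HT Hs1 Hx) as [w Hw].
    exists w. split; [exact Hw|].
    apply (Hmax) with s; [|exact Ks|exact Hw].
    intros s1 Ks1. destruct (Hint s1 Ks1) as [H|H]; [left; exact H|right].
    intros w1. apply bounded_below_resolvent_le; [exact Hc|].
    apply Hbb; [|exact H]. assert (H' := HKq s1 Ks1). lra. }
  assert (Hce := cauchy_estimate X m T q B (norm x / c) x HT
    ltac:(unfold q; lra) Hx Hcirc).
  assert (Hl := Hlow m (conj Hm (le_n m))).
  assert (Hqm : 0 <= q ^ m) by (apply pow_le; unfold q; lra).
  apply (Rmult_le_compat_l _ _ _ Hqm) in Hl.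
  apply Rmult_le_reg_r with (norm x); [exact Hnx|].
  rewrite Rpow_mult_distr.
  replace (/ c * norm x) with (norm x / c) by (unfold Rdiv; ring).
  apply Rle_trans with (2 := Hce). rewrite Rmult_assoc. exact Hl. }
assert (Hqr : 1 < q * r).
{ unfold q. replace ((/ r + d / 2) * r) with (1 + d / 2 * r) by (field; lra).
  assert (H : 0 < d / 2 * r) by (apply Rmult_lt_0_compat; lra). lra. }
destruct (Pow_x_infinity (q * r)) with (b := / c + 1) as [n Hn].
{ rewrite Rabs_pos_eq; lra. }
assert (H := Hn (S n) ltac:(lia)). rewrite Rabs_pos_eq in H by (apply pow_le; lra).
assert (H' := Hgrow (S n) ltac:(lia)). lra.
Qed.

End Separation.

(** * The spectrum *)

Section Spectrum.
Variable X : CompleteNormedModule C_AbsRing.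
Variable T : X -> X.
Hypothesis HT : is_linear T.

Lemma singular_point_neq_0 (s : C) : singular_point X T s -> s <> 0%C.
Proof.
intros Hs ->. apply Hs. exists 1. split; [lra|]. intros w.
replace (minus w (scal (RtoC 0) (T w))) with w
  by (lin_coefs (w :: T w :: nil); ring).
lra.
Qed.

(** A bounded inverse of [T - 1 / s] bounds [1 - s T] from below. *)
Lemma singular_point_spectrum (s : C) :
  singular_point X T s -> spectrum T (Cinv s).
Proof.
intros Hs [S [HS [HST _]]]. assert (Hs0 := singular_point_neq_0 s Hs). apply Hs.
destruct (linear_norm _ HS) as [N [HN HSN]].
assert (Hm : 0 < Cmod (Cinv s)).
{ rewrite (Cmod_inv s Hs0). apply Rinv_0_lt_compat, Cmod_gt_0, Hs0. }
exists (/ (N * Cmod (Cinv s))). split.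
{ apply Rinv_0_lt_compat, Rmult_lt_0_compat; assumption. }
intros w. assert (H := HSN (minus (T w) (scal (Cinv s) w))). rewrite HST in H.
assert (H1 : norm (minus (T w) (scal (Cinv s) w)) <=
             Cmod (Cinv s) * norm (minus w (scal s (T w)))).
{ rewrite <- Cmod_opp.
  replace (minus (T w) (scal (Cinv s) w))
    with (scal (Copp (Cinv s)) (minus w (scal s (T w))))
    by (lin_coefs (w :: T w :: nil); field; exact Hs0).
  apply norm_scal_Cmod. }
apply (Rmult_le_compat_l N) in H1; [|lra].
apply Rmult_le_reg_l with (N * Cmod (Cinv s)); [apply Rmult_lt_0_compat; lra|].
rewrite <- Rmult_assoc, Rinv_r by (apply Rgt_not_eq, Rmult_lt_0_compat; lra). lra.
Qed.

Lemma Cmod_Cinv_minus_lt (s s' : C) (e : R) :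
  s <> 0%C -> 0 < e -> Cmod (Cminus s' s) < Cmod s / 2 ->
  Cmod (Cminus s' s) < e * (Cmod s * Cmod s / 2) ->
  Cmod (Cminus (Cinv s') (Cinv s)) < e.
Proof.
intros Hs He H1 H2. assert (Hm := proj1 (Cmod_gt_0 s) Hs).
assert (Hm' : Cmod s / 2 < Cmod s').
{ rewrite Cmod_minus_sym in H1. assert (K := Cmod_triangle_minus s s').
  rewrite Cmod_minus_sym in H1. lra. }
assert (Hs' : s' <> 0%C) by (apply Cmod_gt_0; lra).
replace (Cminus (Cinv s') (Cinv s)) with (Cdiv (Cminus s s') (Cmult s s'))
  by (field; auto).
rewrite Cmod_div by (apply Cmult_neq_0; assumption).
rewrite Cmod_mult, (Cmod_minus_sym s s').
assert (Hp : 0 < Cmod s * Cmod s') by (apply Rmult_lt_0_compat; lra).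
apply Rmult_lt_reg_r with (Cmod s * Cmod s'); [exact Hp|].
replace (Cmod (Cminus s' s) / (Cmod s * Cmod s') * (Cmod s * Cmod s'))
  with (Cmod (Cminus s' s)) by (field; lra).
apply Rlt_trans with (1 := H2). apply Rmult_lt_compat_l; [exact He|].
replace (Cmod s * Cmod s / 2) with (Cmod s * (Cmod s / 2)) by field.
apply Rmult_lt_compat_l; assumption.
Qed.

(** Inversion is continuous off 0, and 0 is not a singular point: intersecting with
    the singular points removes the trouble that an unbounded [F] would cause
    at 0. *)
Lemma singular_point_inverse_closed (F : C -> Prop) :
  metric_closed F -> metric_closed (fun s => singular_point X T s /\ F (Cinv s)).
Proof.
intros HF s Hs.
destruct (classic (singular_point X T s)) as [Hsing|Hreg].
- assert (Hs0 := singular_point_neq_0 s Hsing).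
  assert (Hm := proj1 (Cmod_gt_0 s) Hs0).
  destruct (HF (Cinv s)) as [e [He Hn]]; [intros H; apply Hs; auto|].
  exists (Rmin (Cmod s / 2) (e * (Cmod s * Cmod s / 2))).
  assert (Hp : 0 < Cmod s * Cmod s) by (apply Rmult_lt_0_compat; lra).
  split.
  { apply Rmin_glb_lt; [lra|]. apply Rmult_lt_0_compat; lra. }
  intros s' Hs' [_ H]. apply (Hn (Cinv s')); [|exact H].
  apply Cmod_Cinv_minus_lt; trivial.
  + apply Rlt_le_trans with (1 := Hs'), Rmin_l.
  + apply Rlt_le_trans with (1 := Hs'), Rmin_r.
- destruct (singular_point_closed X T HT s Hreg) as [e [He Hn]].
  exists e. split; [exact He|]. intros s' Hs' [H _]. exact (Hn s' Hs' H).
Qed.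

Lemma metric_closed_and (F G : C -> Prop) :
  metric_closed F -> metric_closed G -> metric_closed (fun z => F z /\ G z).
Proof.
intros HF HG z Hz. destruct (classic (F z)) as [Fz|Fz].
- destruct (HG z) as [e [He Hn]]; [intros H; apply Hz; auto|].
  exists e. split; [exact He|]. intros z' Hz' [_ H]. exact (Hn z' Hz' H).
- destruct (HF z Fz) as [e [He Hn]].
  exists e. split; [exact He|]. intros z' Hz' [H _]. exact (Hn z' Hz' H).
Qed.

Lemma metric_closed_Cmod_le (a : R) : metric_closed (fun z => Cmod z <= a).
Proof.
intros z Hz. apply Rnot_le_lt in Hz. exists (Cmod z - a). split; [lra|].
intros z' Hz' H. assert (K := Cmod_triangle_minus z z'). lra.
Qed.

Lemma metric_closed_Cmod_ge (a : R) : metric_closed (fun z => a <= Cmod z).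
Proof.
intros z Hz. apply Rnot_le_lt in Hz. exists (a - Cmod z). split; [lra|].
intros z' Hz' H. rewrite Cmod_minus_sym in Hz'.
assert (K := Cmod_triangle_minus z' z). lra.
Qed.

Lemma closed_metric_closed (F : C -> Prop) :
  @closed C_UniformSpace F -> metric_closed F.
Proof.
intros HF z Hz. apply NNPP. intros Hn. apply Hz, HF. intros [e He]. apply Hn.
exists e. split; [apply cond_pos|]. intros z' Hz'. apply He.
exact (C_NormedModule_mixin_compat1 z z' e Hz').
Qed.

Lemma SDCC_spectrum_separation (r : R) (F1 F2 : C -> Prop) :
  SDCC T r -> metric_closed F1 -> metric_closed F2 ->
  (forall z, ~ (F1 z /\ F2 z)) ->
  (forall z, F1 z -> Cmod z < r) -> (forall z, F2 z -> 1 < Cmod z) ->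
  ~ (forall z, spectrum T z -> F1 z \/ F2 z).
Proof.
intros HS C1 C2 Hdisj H1 H2 Hcov. assert (Hr := proj1 HS).
assert (Hinv : forall s, singular_point X T s -> 0 < Cmod s).
{ intros s Hs. apply Cmod_gt_0, singular_point_neq_0, Hs. }
apply (SDCC_no_separation X T HT r
  (fun s => singular_point X T s /\ F1 (Cinv s))
  (fun s => singular_point X T s /\ F2 (Cinv s)) HS).
- apply singular_point_inverse_closed, C1.
- apply singular_point_inverse_closed, C2.
- intros s [[_ A1] [_ A2]]. exact (Hdisj _ (conj A1 A2)).
- intros s [Hs Fs]. apply H1 in Fs. rewrite (Cmod_inv s (singular_point_neq_0 s Hs)) in Fs.
  rewrite <- (Rinv_inv (Cmod s)). apply Rinv_lt_contravar; [|exact Fs].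
  apply Rmult_lt_0_compat; [apply Rinv_0_lt_compat, Hinv, Hs|lra].
- intros s [Hs Fs]. apply H2 in Fs. rewrite (Cmod_inv s (singular_point_neq_0 s Hs)) in Fs.
  rewrite <- (Rinv_inv (Cmod s)), <- Rinv_1. apply Rinv_lt_contravar; [|exact Fs].
  lra.
- intros s Hs. destruct (Hcov _ (singular_point_spectrum s Hs)) as [H|H]; auto.
Qed.

(** If no singular point has modulus [1 / r0], both closed halves that this circle
    cuts out of the singular points stay away from it; hence [1 <= r0 <= r]
    suffices, with equality allowed on either side. *)
Lemma SDCC_spectrum_circle (r r0 : R) :
  SDCC T r -> 1 <= r0 <= r -> exists z : C, spectrum T z /\ Cmod z = r0.
Proof.
intros HS Hr0. apply NNPP. intros Hn.
assert (Hr := proj1 HS).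
assert (Hcirc : forall s, singular_point X T s -> Cmod s <> / r0).
{ intros s Hs E. apply Hn. exists (Cinv s).
  split; [apply singular_point_spectrum, Hs|]. 
  rewrite (Cmod_inv s (singular_point_neq_0 s Hs)), E. apply Rinv_inv. }
assert (Hi1 : / r0 <= 1) by (rewrite <- Rinv_1; apply Rinv_le_contravar; lra).
assert (Hi2 : / r <= / r0) by (apply Rinv_le_contravar; lra).
apply (SDCC_no_separation X T HT r
  (fun s => singular_point X T s /\ / r0 <= Cmod s)
  (fun s => singular_point X T s /\ Cmod s <= / r0) HS).
- apply metric_closed_and;
    [exact (singular_point_closed X T HT)|apply metric_closed_Cmod_ge].
- apply metric_closed_and;
    [exact (singular_point_closed X T HT)|apply metric_closed_Cmod_le].
- intros s [[Hs A1] [_ A2]]. apply (Hcirc s Hs). lra.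
- intros s [Hs A]. assert (H := Hcirc s Hs). lra.
- intros s [Hs A]. assert (H := Hcirc s Hs). lra.
- intros s Hs. destruct (Rle_dec (/ r0) (Cmod s)); [left|right]; split; auto; lra.
Qed.

End Spectrum.

(** * The complexification of a real operator *)

Lemma SDCC_complexify (X : CompleteNormedModule R_AbsRing) (T : X -> X) (r : R) :
  is_linear T -> SDCC T r -> SDCC (complexify X T) r.
Proof.
intros HT [Hr H]. split; [exact Hr|]. intros m Hm.
destruct (H m Hm) as (x & Hx & Hlim & Hlow).
assert (HT0 : T zero = zero) by exact (linear_zero T HT).
set (z := (x, zero) : complexification X).
assert (Hiter : forall k, Nat.iter k (complexify X T) z = (Nat.iter k T x, zero)).
{ induction k as [|k IH]; [reflexivity|].
  transitivity (complexify X T (Nat.iter k T x, zero));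
    [exact (f_equal (complexify X T) IH)|].
  unfold complexify; cbn [fst snd]. rewrite HT0. reflexivity. }
assert (Hnorm : forall k, norm (Nat.iter k (complexify X T) z) = norm (Nat.iter k T x)).
{ intros k.
  transitivity (norm ((Nat.iter k T x, zero) : complexification X)).
  - exact (f_equal (@norm C_AbsRing (complexification X)) (Hiter k)).
  - exact (cplx_norm_real X (Nat.iter k T x)). }
exists z. split; [|split].
- intros E. apply Hx. exact (f_equal fst E).
- apply is_lim_seq_ext with (2 := Hlim). intros k. symmetry. apply Hnorm.
- intros i Hi.
  apply Rle_trans with (norm (Nat.iter i T x)); [|right; symmetry; exact (Hnorm i)].
  apply Rle_trans with (2 := Hlow i Hi). right. f_equal. exact (Hnorm 0%nat).
Qed.

Theorem theorem13 :
  (forall (X : CompleteNormedModule C_AbsRing) (T : X -> X) (r : R),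
     is_linear T -> SDCC T r ->
     (forall r0 : R, 1 <= r0 <= r ->
        exists z : C, spectrum T z /\ Cmod z = r0) /\
     ~ (exists F1 F2 : C -> Prop,
          closed F1 /\ closed F2 /\
          (forall z : C, ~ (F1 z /\ F2 z)) /\
          (forall z : C, F1 z -> Cmod z < r) /\
          (forall z : C, F2 z -> 1 < Cmod z) /\
          (forall z : C, F1 z \/ F2 z <-> spectrum T z)))
  /\
  (forall (X : CompleteNormedModule R_AbsRing) (T : X -> X) (r : R),
     is_linear T -> SDCC T r ->
     (forall r0 : R, 1 <= r0 <= r ->
        exists z : C, spectrum (complexify X T) z /\ Cmod z = r0) /\
     ~ (exists F1 F2 : C -> Prop,
          closed F1 /\ closed F2 /\
          (forall z : C, ~ (F1 z /\ F2 z)) /\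
          (forall z : C, F1 z -> Cmod z < r) /\
          (forall z : C, F2 z -> 1 < Cmod z) /\
          (forall z : C, F1 z \/ F2 z <-> spectrum (complexify X T) z))).
Proof.
assert (Hcomplex : forall (X : CompleteNormedModule C_AbsRing) (T : X -> X) (r : R),
     is_linear T -> SDCC T r ->
     (forall r0 : R, 1 <= r0 <= r ->
        exists z : C, spectrum T z /\ Cmod z = r0) /\
     ~ (exists F1 F2 : C -> Prop,
          closed F1 /\ closed F2 /\
          (forall z : C, ~ (F1 z /\ F2 z)) /\
          (forall z : C, F1 z -> Cmod z < r) /\
          (forall z : C, F2 z -> 1 < Cmod z) /\
          (forall z : C, F1 z \/ F2 z <-> spectrum T z))).
{ intros X T r HT HS. split.
  - intros r0 Hr0. exact (SDCC_spectrum_circle X T HT r r0 HS Hr0).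
  - intros (F1 & F2 & C1 & C2 & Hd & H1 & H2 & Hspec).
    apply (SDCC_spectrum_separation X T HT r F1 F2); trivial.
    + apply closed_metric_closed, C1.
    + apply closed_metric_closed, C2.
    + intros z. apply Hspec. }
split; [exact Hcomplex|]. intros X T r HT HS.
exact (Hcomplex (complexification X) (complexify X T) r (complexify_linear X T HT)
  (SDCC_complexify X T r HT HS)).
Qed.
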